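(* Let $K$ be a field, let $h\ge 2$ be an integer and let $$B_h=\langle (2h-1)2h,\ (2h-1)(2h+1),\ 2h(2h+1),\ 2h(2h+1)+2h-1\rangle .$$ Then $\mu(I_{B_h}^* )=\mu(I_{B_h})=4h$, and $\operatorname{gr}_{\mathfrak m}K[B_h]$ is Cohen–Macaulay.
   Context: For a numerical semigroup $L$ (a subsemigroup of $\mathbb{N}$ containing $0$) with minimal generators $b_1<\dots<b_s$, $K[L]\subset K[t]$ is the $K$-subalgebra generated by $t^{b_1},\dots,t^{b_s}$; with $S=K[x_1,\dots,x_s]$, $I_L\subset S$ is the kernel of the $K$-algebra map $S\to K[t]$, $x_i\mapsto t^{b_i}$. The ring $\operatorname{gr}_{\mathfrak m}K[L]$ is the associated graded ring of $K[L]$ with respect to $\mathfrak m=(t^{b_1},\dots,t^{b_s})$. For a nonzero polynomial $f$, $f^*$ is its nonzero homogeneous component of least degree (standard grading), and $I_L^*=(f^*: f\in I_L, f\neq 0)$. For an ideal $J$, $\mu(J)$ is its minimal number of generators. *)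

(* Defs.v *)
From HB Require Import structures.
From mathcomp Require Import all_boot all_order all_algebra zify ring.
From mathcomp Require Import boolp classical_sets.
From mathcomp Require Import mpoly.

Set Implicit Arguments.
Unset Strict Implicit.
Unset Printing Implicit Defensive.

Import GRing.Theory.
Local Open Scope classical_set_scope.
Local Open Scope quotient_scope.
Local Open Scope ring_scope.

(** * Ideals given by generators *)

Definition ideal_gen (R : comNzRingType) (A : set R) : set R :=
  [set x | exists (n : nat) (c a : 'I_n -> R),
     (forall i, A (a i)) /\ x = \sum_(i < n) c i * a i].

(* [num_gens J n]: n is the least cardinality of a generating set of J. *)
Definition num_gens (R : comNzRingType) (J : set R) (n : nat) : Prop :=
  (exists2 s : seq R, J = ideal_gen [set` s] & size s = n) /\
  (forall s : seq R, J = ideal_gen [set` s] -> (n <= size s)%N).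

Fixpoint ideal_pow (R : comNzRingType) (I : {pred R}) (n : nat) : set R :=
  if n is k.+1
  then ideal_gen [set z | exists x y, [/\ x \in I, ideal_pow I k y & z = x * y]]
  else setT.

Section IdealGen.
Variable R : comNzRingType.
Implicit Types (A J : set R) (I : idealr R).

Lemma ideal_gen0 A : ideal_gen A 0.
Proof.
by exists 0%N, (fun=> 0), (fun=> 0); split=> [[]|] //; rewrite big_ord0.
Qed.

Lemma ideal_gen_sub A x : A x -> ideal_gen A x.
Proof.
move=> Ax; exists 1%N, (fun=> 1), (fun=> x); split=> //.
by rewrite big_ord1 mul1r.
Qed.

Lemma ideal_genM A a x : ideal_gen A x -> ideal_gen A (a * x).
Proof.
move=> [n [c [g [Ag ->]]]]; exists n, (fun i => a * c i), g; split=> //.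
by rewrite mulr_sumr; apply: eq_bigr => i _; rewrite mulrA.
Qed.

Lemma ideal_genD A x y : ideal_gen A x -> ideal_gen A y -> ideal_gen A (x + y).
Proof.
move=> [n [c [g [Ag ->]]]] [m [d [h [Ah ->]]]].
exists (n + m)%N, (fun i => match split i with inl j => c j | inr j => d j end),
  (fun i => match split i with inl j => g j | inr j => h j end).
split=> [i|]; first by case: (split i).
rewrite big_split_ord /=; congr (_ + _); apply: eq_bigr => i _.
  by rewrite -[lshift m i]/(unsplit (inl i)) unsplitK.
by rewrite -[rshift n i]/(unsplit (inr i)) unsplitK.
Qed.

Lemma ideal_gen_least A J : J 0 -> (forall x y, J x -> J y -> J (x + y)) ->
  (forall a x, J x -> J (a * x)) -> A `<=` J -> ideal_gen A `<=` J.
Proof.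
move=> J0 JD JM AJ x [n [c [g [Ag ->]]]].
by apply: (big_ind J) => // i _; apply: JM; apply: AJ.
Qed.

Lemma ideal_pow_gen0 I n : ideal_pow I n 0.
Proof. by case: n => //= n; apply: ideal_gen0. Qed.

Lemma ideal_powM I n a x : ideal_pow I n x -> ideal_pow I n (a * x).
Proof. by case: n => //= n; apply: ideal_genM. Qed.

Lemma ideal_powD I n x y :
  ideal_pow I n x -> ideal_pow I n y -> ideal_pow I n (x + y).
Proof. by case: n => //= n; apply: ideal_genD. Qed.

Lemma ideal_pow_sum I n m (F : 'I_m -> R) :
  (forall i, ideal_pow I n (F i)) -> ideal_pow I n (\sum_(i < m) F i).
Proof.
move=> IF; apply: (big_ind (ideal_pow I n)) => //.
  exact: ideal_pow_gen0.
by move=> x y; apply: ideal_powD.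
Qed.

Lemma ideal_powS I n x : ideal_pow I n.+1 x -> ideal_pow I n x.
Proof.
apply: ideal_gen_least; [exact: ideal_pow_gen0 |by move=> *; apply: ideal_powD
  | by move=> *; apply: ideal_powM |].
by move=> z [u [v [_ Iv ->]]]; apply: ideal_powM.
Qed.

Lemma ideal_pow_mul I n m x y :
  ideal_pow I n x -> ideal_pow I m y -> ideal_pow I (n + m) (x * y).
Proof.
elim: n x => [|n IHn] x Ix Iy; first by rewrite add0n; apply: ideal_powM.
rewrite addSn; move: x Ix.
apply: (@ideal_gen_least _ (fun x => ideal_pow I (n + m).+1 (x * y))).
- by rewrite mul0r; apply: ideal_pow_gen0.
- by move=> u v Iu Iv; rewrite mulrDl; apply: ideal_powD.
- by move=> a u Iu; rewrite -mulrA; apply: ideal_powM.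
move=> z [u [v [uI Iv ->]]]; apply: ideal_gen_sub.
by exists u, (v * y); rewrite mulrA; split=> //; apply: IHn.
Qed.

Lemma ideal_pow1 I x : ideal_pow I 1 x -> x \in I.
Proof.
apply: (@ideal_gen_least _ (fun x => x \in I)).
- exact: idealr0.
- by move=> u v; apply: rpredD.
- by move=> a u; apply: idealMr.
by move=> z [u [v [uI _ ->]]]; rewrite mulrC; apply: idealMr.
Qed.

End IdealGen.

(** * The associated graded ring

    With A[T] = {poly A}, the direct sum of the powers I^i is the subring of
    the polynomials whose i-th coefficient lies in I^i, and the direct sum of
    the quotients I^i / I^(i+1) is its quotient by the ideal of the polynomials
    whose i-th coefficient lies in I^(i+1). *)

Section AssociatedGraded.
Variables (A : comNzRingType) (I : idealr A).

Definition rees_pred : {pred {poly A}} :=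
  fun p => `[< forall i, ideal_pow I i p`_i >].

Lemma rees_subring_closed : subring_closed rees_pred.
Proof.
split=> [|p q /asboolP Ip /asboolP Iq|p q /asboolP Ip /asboolP Iq];
  apply/asboolP => i.
- by rewrite coef1; case: i => [|i] //=; apply: ideal_gen0.
- rewrite coefB; apply: ideal_powD => //.
  by rewrite -mulN1r; apply: ideal_powM.
rewrite coefM; apply: ideal_pow_sum => j.
by rewrite -{1}(subnKC (ltn_ord j : (j <= i)%N)); apply: ideal_pow_mul.
Qed.

HB.instance Definition _ :=
  GRing.isSubringClosed.Build {poly A} rees_pred rees_subring_closed.

Record rees := Rees { rees_val :> {poly A}; _ : rees_val \in rees_pred }.

HB.instance Definition _ := [isSub for rees_val].
HB.instance Definition _ := [Choice of rees by <:].
HB.instance Definition _ := [SubChoice_isSubComNzRing of rees by <:].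

Definition rees_shift : {pred rees} :=
  fun p => `[< forall i, ideal_pow I i.+1 (rees_val p)`_i >].

Lemma rees_shift_idealr : idealr_closed rees_shift.
Proof.
split=> [||a u v /asboolP Iu /asboolP Iv].
- by apply/asboolP => i; rewrite -[rees_val 0]/0 coef0; apply: ideal_pow_gen0.
- apply/negP => /asboolP /(_ 0%N); rewrite -[rees_val 1]/1 coef1 /=.
  by move=> /ideal_pow1; rewrite idealr1.
apply/asboolP => i.
rewrite -[rees_val _]/(rees_val a * rees_val u + rees_val v) coefD.
apply: ideal_powD => //; rewrite coefM; apply: ideal_pow_sum => j.
rewrite -{1}(subnKC (ltn_ord j : (j <= i)%N)) -addnS.
by apply: ideal_pow_mul => //; case: a => a /= /asboolP.
Qed.

HB.instance Definition _ := isIdealr.Build rees rees_shift rees_shift_idealr.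

Definition gr : comNzRingType := {ideal_quot rees_shift}.

End AssociatedGraded.

(** * Localization at a prime ideal *)

Section Localization.
Variables (R : comNzRingType) (P : prime_idealr R).

Record locfrac := LocFrac { locpair : R * R; _ : locpair.2 \notin P }.

HB.instance Definition _ := [isSub for locpair].
HB.instance Definition _ := [Choice of locfrac by <:].

Implicit Types x y z : locfrac.
Local Notation "'\n_' x" := (locpair x).1 (at level 8, x at level 2).
Local Notation "'\d_' x" := (locpair x).2 (at level 8, x at level 2).

Lemma locdenP x : \d_x \notin P. Proof. by case: x. Qed.

Lemma prime_notinM u v : u \notin P -> v \notin P -> u * v \notin P.
Proof. by rewrite prime_idealrM negb_or => -> ->. Qed.

Lemma prime_notin1 : 1 \notin P. Proof. by rewrite idealr1. Qed.

Definition loc_equiv x y : bool :=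
  `[< exists2 u, u \notin P & u * (\n_x * \d_y - \n_y * \d_x) = 0 >].

Lemma loc_equiv_refl : reflexive loc_equiv.
Proof. by move=> x; apply/asboolP; exists 1; rewrite ?prime_notin1 // subrr mulr0. Qed.

Lemma loc_equiv_sym x y : loc_equiv x y = loc_equiv y x.
Proof.
apply/asboolP/asboolP => -[u uP E]; exists u => //;
  by rewrite -opprB mulrN E oppr0.
Qed.

Lemma loc_equiv_trans : transitive loc_equiv.
Proof.
move=> y x z /asboolP [u uP Eu] /asboolP [v vP Ev]; apply/asboolP.
exists (u * v * \d_y); first by rewrite !prime_notinM ?locdenP.
transitivity (v * \d_z * (u * (\n_x * \d_y - \n_y * \d_x))
            + u * \d_x * (v * (\n_y * \d_z - \n_z * \d_y))); first by ring.
by rewrite Eu Ev !mulr0 addr0.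
Qed.

Canonical loc_equiv_equiv :=
  EquivRel loc_equiv loc_equiv_refl loc_equiv_sym loc_equiv_trans.

Definition localization := {eq_quot loc_equiv}.

HB.instance Definition _ : EqQuotient _ loc_equiv localization :=
  EqQuotient.on localization.
HB.instance Definition _ := Choice.on localization.

Lemma loc_eqP x y : reflect
  (exists2 u, u \notin P & u * (\n_x * \d_y - \n_y * \d_x) = 0)
  (x == y %[mod localization]).
Proof. by rewrite eqmodE; apply: asboolP. Qed.

Lemma loc_repr x : exists2 u, u \notin P &
  u * (\n_(repr (\pi_localization x)) * \d_x
       - \n_x * \d_(repr (\pi_localization x))) = 0.
Proof. by apply/loc_eqP; rewrite reprK. Qed.

Definition locfrac_of r : locfrac := @LocFrac (r, 1) prime_notin1.

Definition addf x y : locfrac :=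
  @LocFrac (\n_x * \d_y + \n_y * \d_x, \d_x * \d_y)
    (prime_notinM (locdenP x) (locdenP y)).
Definition mulf x y : locfrac :=
  @LocFrac (\n_x * \n_y, \d_x * \d_y) (prime_notinM (locdenP x) (locdenP y)).
Definition oppf x : locfrac := @LocFrac (- \n_x, \d_x) (locdenP x).

Definition loc0 : localization := lift_cst localization (locfrac_of 0).
Definition loc1 : localization := lift_cst localization (locfrac_of 1).
Definition loc_add := lift_op2 localization addf.
Definition loc_mul := lift_op2 localization mulf.
Definition loc_opp := lift_op1 localization oppf.

Canonical pi_loc0_morph := PiConst loc0.
Canonical pi_loc1_morph := PiConst loc1.

Lemma pi_loc_add : {morph \pi : x y / addf x y >-> loc_add x y}.
Proof.
move=> x y; unlock loc_add; apply/eqP/loc_eqP => /=.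
have [u uP Eu] := loc_repr x; have [v vP Ev] := loc_repr y.
move: (repr (\pi x)) (repr (\pi y)) Eu Ev => x' y' Eu Ev.
exists (u * v); first by rewrite prime_notinM.
transitivity (- (u * (\n_x' * \d_x - \n_x * \d_x')) * v * \d_y * \d_y'
  - (v * (\n_y' * \d_y - \n_y * \d_y')) * u * \d_x * \d_x'); first by ring.
by rewrite Eu Ev oppr0 !mul0r subr0.
Qed.
Canonical pi_loc_add_morph := PiMorph2 pi_loc_add.

Lemma pi_loc_mul : {morph \pi : x y / mulf x y >-> loc_mul x y}.
Proof.
move=> x y; unlock loc_mul; apply/eqP/loc_eqP => /=.
have [u uP Eu] := loc_repr x; have [v vP Ev] := loc_repr y.
move: (repr (\pi x)) (repr (\pi y)) Eu Ev => x' y' Eu Ev.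
exists (u * v); first by rewrite prime_notinM.
transitivity (- (u * (\n_x' * \d_x - \n_x * \d_x')) * v * \n_y * \d_y'
  - (v * (\n_y' * \d_y - \n_y * \d_y')) * u * \n_x' * \d_x); first by ring.
by rewrite Eu Ev oppr0 !mul0r subr0.
Qed.
Canonical pi_loc_mul_morph := PiMorph2 pi_loc_mul.

Lemma pi_loc_opp : {morph \pi : x / oppf x >-> loc_opp x}.
Proof.
move=> x; unlock loc_opp; apply/eqP/loc_eqP => /=.
have [u uP Eu] := loc_repr x; exists u => //.
move: (repr (\pi x)) Eu => x' Eu.
transitivity (u * (\n_x' * \d_x - \n_x * \d_x')); first by ring.
by rewrite Eu.
Qed.
Canonical pi_loc_opp_morph := PiMorph1 pi_loc_opp.

Lemma loc_eq x y : \n_x * \d_y = \n_y * \d_x -> \pi_localization x = \pi y.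
Proof.
by move=> E; apply/eqP/loc_eqP; exists 1; rewrite ?prime_notin1 // E subrr mulr0.
Qed.

Lemma loc_addA : associative loc_add.
Proof.
elim/quotW=> x; elim/quotW=> y; elim/quotW=> z; rewrite !piE.
by apply: loc_eq => /=; ring.
Qed.

Lemma loc_addC : commutative loc_add.
Proof.
by elim/quotW=> x; elim/quotW=> y; rewrite !piE; apply: loc_eq => /=; ring.
Qed.

Lemma loc_add0 : left_id loc0 loc_add.
Proof. by elim/quotW=> x; rewrite !piE; apply: loc_eq => /=; ring. Qed.

Lemma loc_addN : left_inverse loc0 loc_opp loc_add.
Proof. by elim/quotW=> x; rewrite !piE; apply: loc_eq => /=; ring. Qed.

HB.instance Definition _ :=
  GRing.isZmodule.Build localization loc_addA loc_addC loc_add0 loc_addN.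

Lemma loc_mulA : associative loc_mul.
Proof.
elim/quotW=> x; elim/quotW=> y; elim/quotW=> z; rewrite !piE.
by apply: loc_eq => /=; ring.
Qed.

Lemma loc_mulC : commutative loc_mul.
Proof.
by elim/quotW=> x; elim/quotW=> y; rewrite !piE; apply: loc_eq => /=; ring.
Qed.

Lemma loc_mul1 : left_id loc1 loc_mul.
Proof. by elim/quotW=> x; rewrite !piE; apply: loc_eq => /=; ring. Qed.

Lemma loc_mulDl : left_distributive loc_mul loc_add.
Proof.
elim/quotW=> x; elim/quotW=> y; elim/quotW=> z; rewrite !piE.
by apply: loc_eq => /=; ring.
Qed.

Lemma loc_1neq0 : loc1 != loc0.
Proof.
apply/negP; rewrite piE => /asboolP [u uP] /=.
by rewrite mul1r mul0r subr0 mulr1 => u0; rewrite u0 idealr0 in uP.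
Qed.

HB.instance Definition _ := GRing.Zmodule_isComNzRing.Build localization
  loc_mulA loc_mulC loc_mul1 loc_mulDl loc_1neq0.

End Localization.

(** * Cohen-Macaulay rings *)

Section CohenMacaulay.
Implicit Type R : comNzRingType.

(* [idealr R] consists of proper ideals. *)
Definition maximal_ideal R (M : idealr R) : Prop :=
  forall J : idealr R, {subset M <= J} -> {subset J <= M}.

Definition local_ring R (M : idealr R) : Prop :=
  maximal_ideal M /\ forall N : idealr R, maximal_ideal N -> N =i M.

Definition noetherian R : Prop :=
  forall J : idealr R, exists s : seq R, [set` J] = ideal_gen [set` s].

Definition prime_chain R (n : nat) : Prop :=
  exists P : 'I_n.+1 -> prime_idealr R, forall i j : 'I_n.+1, (i < j)%N ->
    {subset P i <= P j} /\ ~ {subset P j <= P i}.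

Definition krull_dim R (d : nat) : Prop :=
  prime_chain R d /\ forall n, prime_chain R n -> (n <= d)%N.

Definition regular_seq R (s : seq R) : Prop :=
  (forall i x, (i < size s)%N ->
     ideal_gen [set` take i s] (s`_i * x) -> ideal_gen [set` take i s] x) /\
  ~ ideal_gen [set` s] 1.

Definition depth R (M : idealr R) (d : nat) : Prop :=
  (exists2 s : seq R, regular_seq s & {subset s <= M} /\ size s = d) /\
  (forall s : seq R, regular_seq s -> {subset s <= M} -> (size s <= d)%N).

Definition local_cohen_macaulay R : Prop :=
  exists M : idealr R, [/\ noetherian R, local_ring M &
    exists2 d, krull_dim R d & depth M d].

Definition cohen_macaulay R : Prop :=
  noetherian R /\
  forall P : prime_idealr R, maximal_ideal P ->
    local_cohen_macaulay (localization P).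

End CohenMacaulay.

(** * Numerical semigroups *)

Definition semigroup_gen (s : seq nat) : set nat :=
  [set n | exists c : nat -> nat, n = (\sum_(b <- s) c b * b)%N].

Record numericalSemigroup := NumericalSemigroup {
  carrier :> set nat;
  carrier0 : carrier 0%N;
  carrierD : forall a b, carrier a -> carrier b -> carrier (a + b)%N;
  embdim : nat;
  mingens : embdim.-tuple nat;
  mingens_sorted : sorted ltn mingens;
  mingens_gen : carrier = semigroup_gen mingens;
  mingens_min : forall s : seq nat, {subset s <= mingens} ->
    carrier = semigroup_gen s -> {subset mingens <= s} }.

Lemma semigroup_gen0 s : semigroup_gen s 0%N.
Proof. by exists (fun=> 0%N); rewrite big1. Qed.

Lemma semigroup_genD s a b :
  semigroup_gen s a -> semigroup_gen s b -> semigroup_gen s (a + b)%N.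
Proof.
move=> [c ->] [d ->]; exists (fun i => c i + d i)%N.
by rewrite -big_split; apply: eq_bigr => i _; rewrite mulnDl.
Qed.

Lemma semigroup_gen_mem (s : seq nat) b :
  uniq s -> b \in s -> semigroup_gen s b.
Proof.
move=> us bs; exists (fun i => (i == b) : nat).
rewrite (bigD1_seq b) //= eqxx mul1n big1 ?addn0 // => i /negPf ->.
by rewrite mul0n.
Qed.

Lemma mingens_gt0 (L : numericalSemigroup) b : b \in mingens L -> (0 < b)%N.
Proof.
case: b => // b0; suff /(@mingens_min L) H :
    {subset [seq x <- mingens L | x != 0%N] <= mingens L}.
  have : 0%N \in [seq x <- mingens L | x != 0%N].
    apply: H => //; rewrite mingens_gen.
    have E c : (\sum_(x <- [seq x <- mingens L | x != 0] ) c x * x =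
                \sum_(x <- mingens L) c x * x)%N.
      rewrite big_filter [LHS]big_mkcond /=.
      by apply: eq_bigr => -[|x] _ //=; rewrite muln0.
    by apply: funext => n; apply: propext; split=> -[c ->]; exists c; rewrite E.
  by rewrite mem_filter eqxx.
by move=> x; rewrite mem_filter => /andP[].
Qed.

(** * Semigroup rings and their defining ideals *)

Section SemigroupRing.
Variables (K : fieldType) (L : numericalSemigroup).

Definition toric_ideal : set {mpoly K[embdim L]} :=
  [set f | mmap (@polyC K) (fun i => 'X^(tnth (mingens L) i)) f = 0].

Definition semigroup_ring_pred : {pred {poly K}} :=
  fun p => `[< forall S : {pred {poly K}}, subalg_closed S ->
    (forall i, 'X^(tnth (mingens L) i) \in S) -> p \in S >].

Lemma semigroup_ring_subring_closed : subring_closed semigroup_ring_pred.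
Proof.
split=> [|p q /asboolP Sp /asboolP Sq|p q /asboolP Sp /asboolP Sq];
  apply/asboolP => S Salg SX; case: (Salg) => S1 SZ SM.
- exact: S1.
- by rewrite addrC -scaleN1r; apply: SZ; [apply: Sq | apply: Sp].
by apply: SM; [apply: Sp | apply: Sq].
Qed.

HB.instance Definition _ := GRing.isSubringClosed.Build {poly K}
  semigroup_ring_pred semigroup_ring_subring_closed.

Record semigroup_ring := SemigroupRing {
  semigroup_ring_val :> {poly K};
  _ : semigroup_ring_val \in semigroup_ring_pred }.

HB.instance Definition _ := [isSub for semigroup_ring_val].
HB.instance Definition _ := [Choice of semigroup_ring by <:].
HB.instance Definition _ := [SubChoice_isSubComNzRing of semigroup_ring by <:].

Definition semigroup_ring_max : {pred semigroup_ring} :=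
  fun p => `[< ideal_gen
    [set q : semigroup_ring | exists i, val q = 'X^(tnth (mingens L) i)] p >].

Lemma semigroup_ring_max_idealr : idealr_closed semigroup_ring_max.
Proof.
split=> [||a u v /asboolP Mu /asboolP Mv].
- by apply/asboolP; apply: ideal_gen0.
- apply/negP => /asboolP.
  have sub : ideal_gen [set q : semigroup_ring |
      exists i, val q = 'X^(tnth (mingens L) i)] `<=` [set q | (semigroup_ring_val q)`_0 = 0].
    apply: ideal_gen_least => /=.
    + by rewrite coef0.
    + by move=> x y x0 y0; rewrite coefD x0 y0 addr0.
    + by move=> a x x0; rewrite coefM big_ord1 x0 mulr0.
    move=> x [i /= ->]; rewrite coefXn.
    by have := mingens_gt0 (mem_tnth i (mingens L)); case: (tnth _ _).
  by move/sub => /= /eqP; rewrite coef1 oner_eq0.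
by apply/asboolP; apply: ideal_genD => //; apply: ideal_genM.
Qed.

HB.instance Definition _ :=
  isIdealr.Build semigroup_ring semigroup_ring_max semigroup_ring_max_idealr.

Definition tangent_cone : comNzRingType := gr semigroup_ring_max.

End SemigroupRing.

Arguments toric_ideal : clear implicits.

(** * Initial forms *)

Section InitialForms.
Variables (K : fieldType) (n : nat).

(* [initial_form f g]: g is the nonzero homogeneous component of least degree
   of f, for the standard grading; such a g exists exactly when f != 0. *)
Definition initial_form (f g : {mpoly K[n]}) : Prop :=
  exists d, [/\ g = pihomog mdeg d f, g != 0 &
    forall e, (e < d)%N -> pihomog mdeg e f = 0].

Definition initial_ideal (I : set {mpoly K[n]}) : set {mpoly K[n]} :=
  ideal_gen [set g | exists2 f, I f /\ f != 0 & initial_form f g].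

End InitialForms.

(** * The semigroups B_h *)

Section Bresinsky.
Variables (h : nat) (h_ge2 : (2 <= h)%N).

Definition bresinsky_gens : 4.-tuple nat :=
  [tuple (2 * h - 1) * (2 * h); (2 * h - 1) * (2 * h + 1);
         2 * h * (2 * h + 1); 2 * h * (2 * h + 1) + 2 * h - 1]%N.

Lemma bresinsky_sorted : sorted ltn bresinsky_gens.
Proof. by rewrite /=; apply/and4P; split; nia. Qed.

(* Every generator is smaller than twice the least one, so none of them is a
   sum of two or more generators. *)
Lemma bresinsky_min (s : seq nat) : {subset s <= bresinsky_gens} ->
  semigroup_gen bresinsky_gens = semigroup_gen s -> {subset bresinsky_gens <= s}.
Proof.
move=> sB E b bB; set m := ((2 * h - 1) * (2 * h))%N.
have m_le x : x \in (bresinsky_gens : seq nat) -> (m <= x < 2 * m)%N.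
  by rewrite !inE => /or4P[] /eqP ->; rewrite /m; nia.
have : semigroup_gen s b.
  rewrite -E; apply: semigroup_gen_mem => //.
  by apply: sorted_uniq bresinsky_sorted; [exact: ltn_trans | exact: ltnn].
have /andP[mb bm] := m_le _ bB; move=> [c].
have m0 : (0 < m)%N by rewrite /m; nia.
suff H : forall t : seq nat, {subset t <= bresinsky_gens} ->
    let S := (\sum_(x <- t) c x * x)%N in (S < 2 * m)%N -> S = 0%N \/ S \in t.
  by move=> eb; case: (H s sB); rewrite -eb //; lia.
elim=> [|x t IH] sub; first by left; rewrite big_nil.
have /andP[mx xm] := m_le _ (sub _ (mem_head _ _)).
rewrite /= big_cons; set S := (\sum_(_ <- _) _)%N => lt2.
have {IH} /= := IH (fun y yt => sub y (mem_behead (s := x :: t) yt)).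
rewrite -/S => /(_ _) [|S0|St]; first by lia.
  case: (c x) lt2 => [|[|k]] lt2; rewrite ?S0.
  - by left.
  - by right; rewrite mul1n addn0 mem_head.
  - by nia.
have /andP[mS _] := m_le _ (sub _ (mem_behead (s := x :: t) St)).
case: (c x) lt2 => [|k] lt2; last by nia.
by right; rewrite mul0n add0n inE St orbT.
Qed.

Definition bresinsky : numericalSemigroup :=
  @NumericalSemigroup (semigroup_gen bresinsky_gens)
    (@semigroup_gen0 _) (@semigroup_genD _) 4 bresinsky_gens
    bresinsky_sorted erefl bresinsky_min.

End Bresinsky.

(* Main.v *)
Require Import Defs.
From HB Require Import structures.
From mathcomp Require Import all_boot all_order all_algebra zify ring.
From mathcomp Require Import boolp classical_sets mpoly.

Set Implicit Arguments.
Unset Strict Implicit.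
Unset Printing Implicit Defensive.

Import GRing.Theory.
Local Open Scope classical_set_scope.
Local Open Scope quotient_scope.
Local Open Scope ring_scope.

(** Write x, y, z, w for the variables. The toric ideal contains yz - xw,
    z^(2h-1-j) w^j - x^(2h+1-j) y^j (0 <= j <= 2h-1) and
    y^(2h-j) w^j - x^(2h+1-j) z^j (0 <= j <= 2h-2), 4h binomials in all. Used as
    rewriting rules from left to right, they increase the exponent of x and never
    decrease the degree, and they bring every monomial to a normal form which is
    determined by its value under x |-> t^b_1, ..., w |-> t^b_4. Hence they
    generate the ideal, and the rules that increase the degree show that yz - xw
    and the left-hand monomials of the others generate the initial ideal.

    No element of either ideal involves a normal monomial free of x (a standard
    monomial). All proper divisors of the 4h left-hand monomials are standard, so
    f |-> (coefficients of f at these monomials) kills the product of the ideal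
    with (x, y, z, w), while the generators are mapped to the canonical basis of
    K^(4h): fewer generators never suffice.

    In the tangent cone y, z, w are nilpotent, x is regular and the monomials in
    y, z, w span a finite K[x]-module. Such a ring is noetherian, and its primes
    are those of K[x]; at a maximal prime P, whenever r in P is not nilpotent,
    every element of P has a power in rR_P, so both the dimension and the depth
    of R_P are 1. *)

(** * From ideals given as sets to bundled ideals *)

Section IdealOfSet.
Variables (R : comNzRingType) (J : set R).
Hypotheses (J0 : J 0) (J1 : ~ J 1) (JD : forall x y, J x -> J y -> J (x + y))
  (JM : forall a x, J x -> J (a * x)).

(** Maximality and noetherianity quantify over bundled ideals, which are proper by definition; hence
    the hypothesis [J1]. *)
Lemma idealr_of_set : exists I : idealr R, forall x, x \in I = `[< J x >].
Proof.
pose S : {pred R} := fun x => `[< J x >].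
have S_id : idealr_closed S.
  split; [exact/asboolP | by apply/negP => /asboolP|].
  by move=> a u v /asboolP Ju /asboolP Jv; apply/asboolP/JD => //; apply: JM.
pose C := isIdealr.Build R S S_id.
pose I : idealr R := HB.pack S C.
by exists I.
Qed.

Lemma prime_idealr_of_set : (forall x y, J (x * y) -> J x \/ J y) ->
  exists I : prime_idealr R, forall x, x \in I = `[< J x >].
Proof.
move=> Jp; pose S : {pred R} := fun x => `[< J x >].
have S_id : idealr_closed S.
  split; [exact/asboolP | by apply/negP => /asboolP|].
  by move=> a u v /asboolP Ju /asboolP Jv; apply/asboolP/JD => //; apply: JM.
have S_pr : prime_idealr_closed S.
  move=> u v /asboolP /Jp [?|?]; apply/orP; [left|right]; exact/asboolP.
pose C := isIdealr.Build R S S_id.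
pose C' := isPrimeIdealrClosed.Build R S S_pr.
pose I : prime_idealr R := HB.pack S C C'.
by exists I.
Qed.

End IdealOfSet.

(** A witness of [ideal_gen] may list generators repeatedly and in any order; gathering them leaves
    one coefficient per position of [s], the form that the rank argument needs. *)
Lemma ideal_gen_seq_sum (R : comNzRingType) (s : seq R) (x : R) :
  ideal_gen [set` s] x <-> exists c : nat -> R, x = \sum_(i < size s) c i * s`_i.
Proof.
split; last first.
  move=> [c ->]; exists (size s), (fun i => c i), (fun i => s`_i).
  by split=> // i /=; apply: mem_nth.
apply: (@ideal_gen_least _ _ (fun x => exists c : nat -> R,
    x = \sum_(i < size s) c i * s`_i)).
- by exists (fun=> 0); rewrite big1 // => i _; rewrite mul0r.
- move=> a b [c ->] [d ->]; exists (fun i => c i + d i).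
  by rewrite -big_split; apply: eq_bigr => i _; rewrite mulrDl.
- move=> a b [c ->]; exists (fun i => a * c i).
  by rewrite mulr_sumr; apply: eq_bigr => i _; rewrite mulrA.
(* [index] selects a single occurrence, so repeated entries of [s] do no harm. *)
move=> a /= sa; exists (fun i => (i == index a s)%:R).
have ls : (index a s < size s)%N by rewrite index_mem.
rewrite (bigD1 (Ordinal ls)) //= eqxx mul1r nth_index // big1 ?addr0 //.
by move=> i /eqP ne; case: eqP => [e|]; [case: ne; apply: val_inj|rewrite mul0r].
Qed.

(** * Localizations *)

Section LocMap.
Variables (R : comNzRingType) (P : prime_idealr R).
Local Notation L := (localization P).

Definition loc_map (r : R) : L := \pi_L (locfrac_of P r).

Lemma loc_map_is_zmod : zmod_morphism loc_map.
Proof.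
move=> x y; rewrite /loc_map -[RHS]/(loc_add _ (loc_opp _)) -pi_loc_opp.
by rewrite -pi_loc_add; apply: loc_eq => /=; ring.
Qed.

Lemma loc_map_is_monoid : monoid_morphism loc_map.
Proof.
split; first by rewrite /loc_map -[RHS]/(loc1 P) piE.
move=> x y; rewrite /loc_map -[RHS]/(loc_mul _ _) -pi_loc_mul.
by apply: loc_eq => /=; ring.
Qed.

HB.instance Definition _ := GRing.isZmodMorphism.Build R L loc_map loc_map_is_zmod.
HB.instance Definition _ :=
  GRing.isMonoidMorphism.Build R L loc_map loc_map_is_monoid.

(** Clearing the denominator of a fraction hides the quotient construction from the later proofs. *)
Lemma loc_mapP (x : L) : exists r s, s \notin P /\ loc_map s * x = loc_map r.
Proof.
elim/quotW: x => x; exists (locpair x).1, (locpair x).2; split; first exact: locdenP.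
rewrite /loc_map -[LHS]/(loc_mul _ _) -pi_loc_mul.
by apply: loc_eq => /=; ring.
Qed.

Lemma loc_map_eq0 r : loc_map r = 0 <-> exists2 u, u \notin P & u * r = 0.
Proof.
have -> : (0 : L) = \pi_L (locfrac_of P 0) by rewrite -[LHS]/(loc0 P) piE.
rewrite /loc_map; split.
  move=> /eqP /loc_eqP [u uP] /=; rewrite mulr1 mul0r subr0 => e.
  by exists u.
by move=> [u uP e]; apply/eqP/loc_eqP; exists u => //=; rewrite mulr1 mul0r subr0.
Qed.

Lemma loc_map_inv s : s \notin P -> exists y, y * loc_map s = 1.
Proof.
move=> sP; exists (\pi_L (@LocFrac _ P (1, s) sP)).
rewrite /loc_map -[LHS]/(loc_mul _ _) -pi_loc_mul -[RHS]/(loc1 P) piE.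
by apply: loc_eq => /=; ring.
Qed.

(** The maximal ideal consists of the fractions with numerator in [P]; everything outside it is
    invertible, which forces every proper ideal into it. *)
Lemma loc_max_exists :
  exists M : idealr L, [/\ local_ring M,
    (forall r, loc_map r \in M = (r \in P)) &
    forall x, x \notin M -> exists y, y * x = 1].
Proof.
pose J := [set x : L | exists r s, [/\ r \in P, s \notin P &
                                      loc_map s * x = loc_map r]].
(* If [r / 1 = r' / s] with [r'] in [P], then [u s r] is in [P] for some [u] outside [P], and
   primality leaves only [r]. *)
have JE r : J (loc_map r) <-> r \in P.
  split=> [[r' [s [rP sP]]]|rP]; last first.
    by exists r, 1; rewrite rP idealr1 rmorph1 mul1r.
  move=> /eqP; rewrite -subr_eq0 -rmorphM -rmorphB => /eqP /loc_map_eq0 [u uP e].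
  have : u * s * r \in P.
    have -> : u * s * r = u * (s * r - r') + u * r' by ring.
    by rewrite e add0r idealMr.
  by rewrite !prime_idealrM (negPf uP) (negPf sP).
have [|||a x|M ME] := @idealr_of_set L J.
- by rewrite -(rmorph0 loc_map); apply/JE; rewrite idealr0.
- by rewrite -(rmorph1 loc_map) => /JE; rewrite idealr1.
- move=> x y [r [s [rP sP e]]] [r' [s' [rP' sP' e']]].
  exists (s' * r + s * r'), (s * s'); split.
  + by rewrite rpredD // idealMr.
  + exact: prime_notinM.
  + by rewrite rmorphD !rmorphM /= -e -e'; ring.
- move=> [r [s [rP sP e]]]; have [r' [s' [sP' e']]] := loc_mapP a.
  exists (r' * r), (s' * s); split; [exact: idealMr | exact: prime_notinM|].
  by rewrite !rmorphM /= -e -e'; ring.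
have Munit x : x \notin M -> exists y, y * x = 1.
  rewrite ME; have [r [s [sP e]]] := loc_mapP x.
  move=> /asboolPn nJ; have rP : r \notin P.
    by apply/negP => rP; apply: nJ; exists r, s.
  have [y ye] := loc_map_inv rP.
  by exists (y * loc_map s); rewrite -mulrA e.
(* A bundled ideal is proper, so it contains no invertible element. *)
have sub (N : idealr L) : {subset N <= M}.
  move=> x xN; apply/negPn/negP => /Munit [y yx].
  by have := idealMr y xN; rewrite yx idealr1.
exists M; split=> // [|r]; last by rewrite ME; apply/asboolP/idP => /JE.
split=> [N MN|N Nmax]; first exact: sub.
by move=> x; apply/idP/idP; [apply: sub | apply: (Nmax M (sub N))].
Qed.

(** Generators of the contraction to [R] generate the ideal itself, since every fraction is a unit
    multiple of its numerator. *)
Lemma localization_noetherian : noetherian R -> noetherian L.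
Proof.
move=> Rn J.
have [||||I IE] := @idealr_of_set R [set r | loc_map r \in J].
- by rewrite /= rmorph0 idealr0.
- by rewrite /= rmorph1 idealr1.
- by move=> x y /= xJ yJ; rewrite rmorphD rpredD.
- by move=> a x /= xJ; rewrite rmorphM idealMr.
have [s se] := Rn I; exists (map loc_map s).
apply/seteqP; split=> x /=; last first.
  apply: (@ideal_gen_least _ _ [set` J]) => /=.
  - exact: idealr0.
  - by move=> a b; apply: rpredD.
  - by move=> a b; apply: idealMr.
  move=> a /= /mapP [r rs ->].
  have : [set` I] r by rewrite se; apply: ideal_gen_sub.
  by rewrite /= IE => /asboolP.
move=> xJ; have [r [t [tP e]]] := loc_mapP x.
have [y yt] := loc_map_inv tP.
have -> : x = y * loc_map r by rewrite -e mulrA yt mul1r.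
apply: ideal_genM.
have : [set` I] r by rewrite /= IE; apply/asboolP; rewrite /= -e idealMr.
rewrite se => -[n [c [a [as_ ->]]]].
exists n, (fun i => loc_map (c i)), (fun i => loc_map (a i)); split.
  by move=> i; apply: map_f; apply: as_.
by rewrite rmorph_sum; apply: eq_bigr => i _; rewrite rmorphM.
Qed.

End LocMap.

(** * Nilpotent thickenings of the affine line *)

(** Used with a nilpotent [y]: some power of [x] is then a multiple of [x - y]. *)
Lemma exprB_multiple (R : comNzRingType) (x y : R) n :
  exists c, x ^+ n = c * (x - y) + y ^+ n.
Proof.
rewrite -[x ^+ n](subrK (y ^+ n)) subrXX.
by eexists; congr (_ + _); rewrite mulrC.
Qed.

Lemma nilpotent_in_prime (R : comNzRingType) (P : prime_idealr R) (x : R) n :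
  x ^+ n = 0 -> x \in P.
Proof.
move=> x0; have : x ^+ n \in P by rewrite x0 idealr0.
elim: n {x0} => [|n IHn]; first by rewrite expr0 idealr1.
by rewrite exprS prime_idealrM => /orP[].
Qed.

Definition nilpotent_elt (R : comNzRingType) (x : R) := exists n, x ^+ n = 0.

Lemma nilpotent_elt0 (R : comNzRingType) : nilpotent_elt (0 : R).
Proof. by exists 1%N; rewrite expr1. Qed.

Lemma nilpotent_eltM (R : comNzRingType) (a x : R) :
  nilpotent_elt x -> nilpotent_elt (a * x).
Proof. by move=> [n e]; exists n; rewrite exprMn e mulr0. Qed.

Lemma nilpotent_eltD (R : comNzRingType) (x y : R) :
  nilpotent_elt x -> nilpotent_elt y -> nilpotent_elt (x + y).
Proof.
move=> [n xn] [m ym]; exists (n + m)%N.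
rewrite exprDn big1 // => i _; case: (leqP n (n + m - i)) => hi.
  by rewrite -(subnK hi) exprD xn; rewrite !(mulr0, mul0r) mul0rn.
have {}hi : (m <= i)%N by lia.
by rewrite -(subnK hi) exprD ym; rewrite !(mulr0, mul0r) mul0rn.
Qed.

Section NilpotentThickening.
Variables (K : fieldType) (R : comNzRingType) (iota : {rmorphism {poly K} -> R}).
Hypothesis iota_reg : forall p r, p != 0 -> iota p * r = 0 -> r = 0.
Hypothesis iota_dec : forall r, exists p, nilpotent_elt (r - iota p).

(** A power of a nonzero [p] is nonzero and acts injectively, so it cannot kill [1]. With
    [iota_dec], this makes [R] modulo nilpotents a copy of [K[t]]. *)
Lemma iota_nilpotent p : nilpotent_elt (iota p) -> p = 0.
Proof.
move=> [n e]; apply/eqP; apply: contraT => p0; have /eqP[] := oner_neq0 R.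
by apply: (@iota_reg (p ^+ n)); rewrite ?expf_neq0 // mulr1 rmorphXn.
Qed.

(** * Elements of a prime ideal of the thickening *)

Section AtPrime.
Variable P : prime_idealr R.

(** Induction on the degree of [p], dividing by [g = gcd(p, q)]. If [p' = p / g] is outside the
    prime, [p' q = q' p] suffices; otherwise the relation for [p'] is multiplied by [q = q' g]. *)
Lemma poly_prime_power p q : p != 0 -> iota p \in P -> iota q \in P ->
  exists k u c, iota u \notin P /\ u * q ^+ k = c * p.
Proof.
have [n] := ubnP (size p); elim: n p => // n IHn p sp p0 pP qP.
pose g := gcdp p q.
have gP : iota g \in P.
  (* Bezout's identity holds up to a nonzero constant [c], a unit, so [g] itself is mapped into the
     prime. *)
  have [[a b] /= /eqpf_eq [c c0]] := Bezoutp p q.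
  rewrite -mul_polyC => e.
  have : iota (c%:P * g) \in P.
    by rewrite -e rmorphD !rmorphM rpredD ?idealMr.
  rewrite rmorphM prime_idealrM => /orP[cP|//].
  have := idealMr (iota c^-1%:P) cP.
  by rewrite -rmorphM -polyCM mulVf // rmorph1 idealr1.
have /dvdpP [p' pe] : g %| p := dvdp_gcdl p q.
have /dvdpP [q' qe] : g %| q := dvdp_gcdr p q.
have p'0 : p' != 0 by apply: contraNneq p0 => e; rewrite pe e mul0r.
have g0 : g != 0 by apply: contraNneq p0 => e; rewrite pe e mulr0.
have [p'P|p'P] := boolP (iota p' \in P); last first.
  by exists 1%N, p', q'; split=> //; rewrite expr1 qe pe; ring.
(* A constant [g] would put a unit into the prime; hence [p'] has smaller degree than [p]. *)
have sg : (1 < size g)%N.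
  rewrite ltnNge; apply/negP => /size1_polyC e.
  have c0 : g`_0 != 0 by apply: contraNneq g0 => c0; rewrite e c0 polyC0.
  have := idealMr (iota (g`_0)^-1%:P) gP.
  by rewrite e coefC /= -rmorphM -polyCM mulVf // rmorph1 idealr1.
have lt : (size p' < n)%N.
  move: sp; rewrite pe size_mul //.
  have : (0 < size p')%N by rewrite size_poly_gt0.
  by move: sg; move: (size p') (size g) => i j; lia.
have [k [u [c [uP e]]]] := IHn p' lt p'0 p'P qP.
exists k.+1, u, (c * q'); split=> //.
have -> : u * q ^+ k.+1 = (u * q ^+ k) * q by rewrite exprSr mulrA.
by rewrite e {1}qe pe; ring.
Qed.

(** Up to nilpotents [r] and [b] are polynomials [p] and [q]. Some [p ^+ n] is a multiple of [r] and
    [b ^+ m] is a multiple of [q], which reduces the claim to [poly_prime_power] for [p ^+ n] and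
    [q]. *)
Lemma nonnil_prime_power r b : ~ nilpotent_elt r -> r \in P -> b \in P ->
  exists k u c, u \notin P /\ u * b ^+ k = c * r.
Proof.
move=> rn rP bP.
have [p [n pn]] := iota_dec r; have [q [m qm]] := iota_dec b.
have p0 : p != 0.
  by apply: contra_not_neq rn => p0; exists n; rewrite -pn p0 rmorph0 subr0.
have pP : iota p \in P.
  by rewrite -[iota p](subKr r) rpredB // (nilpotent_in_prime _ pn).
have qP : iota q \in P.
  by rewrite -[iota q](subKr b) rpredB // (nilpotent_in_prime _ qm).
have [c ce] := exprB_multiple (iota p) (iota p - r) n.
have [d de] := exprB_multiple b (b - iota q) m.
rewrite subKr in ce; rewrite subKr qm addr0 in de.
rewrite -opprB exprNn pn mulr0 addr0 in ce.
(* The power [p ^+ n] is known to lie in the prime only for positive [n]; for [n = 0], [ce] already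
   makes [1] a multiple of [r]. *)
case: n ce {pn} => [|n] ce.
  exists 0%N, 1, c; split; first exact: prime_notin1.
  by rewrite expr0 mul1r -ce expr0.
have pnP : iota (p ^+ n.+1) \in P by rewrite exprSr rmorphM idealMr.
have [k [u [v [uP e]]]] := poly_prime_power (expf_neq0 n.+1 p0) pnP qP.
exists (m * k)%N, (iota u), (d ^+ k * iota v * c); split=> //.
rewrite exprM de exprMn_comm; last exact: mulrC.
rewrite mulrCA -rmorphXn -rmorphM e rmorphM rmorphXn ce; ring.
Qed.

(** Otherwise [P] lies in the proper ideal of the elements [iota ('X * p) + v] with [v] nilpotent;
    by maximality [P] would contain [iota 'X], which is not nilpotent. *)
Lemma maximal_nonnil : maximal_ideal P ->
  exists2 r, r \in P & ~ nilpotent_elt r.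
Proof.
move=> Pmax; apply: contrapT => nP.
have Pnil r : r \in P -> nilpotent_elt r.
  by move=> rP; apply: contrapT => rn; apply: nP; exists r.
pose J := [set r | exists p v, nilpotent_elt v /\ r = iota ('X * p) + v].
have [||||I IE] := @idealr_of_set R J.
- by exists 0, 0; split; [exact: nilpotent_elt0 | rewrite mulr0 rmorph0 addr0].
- move=> [p [v [vn e]]].
  (* Evaluation at [0] shows that [1 - 'X * p] is never zero. *)
  have /(congr1 (horner^~ 0)) : 1 - 'X * p = 0 :> {poly K}.
    by apply: iota_nilpotent; rewrite rmorphB rmorph1 e addrC addKr.
  by rewrite !hornerE ?mul0r ?subr0 => /eqP; rewrite oner_eq0.
- move=> x y [p [v [vn ->]]] [q [w [wn ->]]].
  exists (p + q), (v + w); split; first exact: nilpotent_eltD.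
  by rewrite mulrDr rmorphD; ring.
- move=> a x [p [v [vn ->]]]; have [q qn] := iota_dec a.
  exists (q * p), ((a - iota q) * iota ('X * p) + a * v); split.
    by apply: nilpotent_eltD; [rewrite mulrC; apply: nilpotent_eltM | apply: nilpotent_eltM].
  by rewrite mulrCA rmorphM; ring.
have XI : iota 'X \in I.
  rewrite IE; apply/asboolP; exists 1, 0; split; first exact: nilpotent_elt0.
  by rewrite mulr1 addr0.
have /Pnil /iota_nilpotent /eqP : iota 'X \in P.
  apply: (Pmax I) => // r rP; rewrite IE; apply/asboolP.
  by exists 0, r; rewrite mulr0 rmorph0 add0r; split=> //; apply: Pnil.
by rewrite polyX_eq0.
Qed.

End AtPrime.

(** Modulo nilpotents a product is the product of the polynomial parts, and [K[t]] has no zero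
    divisors. *)
Lemma nilpotent_prime_ideal : exists N : prime_idealr R,
  forall r, r \in N = `[< nilpotent_elt r >].
Proof.
apply: prime_idealr_of_set.
- exact: nilpotent_elt0.
- by move=> [n /eqP]; rewrite expr1n oner_eq0.
- exact: nilpotent_eltD.
- exact: nilpotent_eltM.
move=> x y xy; have [p pn] := iota_dec x; have [q qn] := iota_dec y.
have /iota_nilpotent/eqP : nilpotent_elt (iota (p * q)).
  have -> : iota (p * q) = x * y + (- iota q * (x - iota p) + - x * (y - iota q)).
    by rewrite rmorphM; ring.
  by do ?apply: nilpotent_eltD => //; apply: nilpotent_eltM.
rewrite mulf_eq0 => /orP[] /eqP e; [left|right].
  by rewrite -[x]subr0 -(rmorph0 iota) -e.
by rewrite -[y]subr0 -(rmorph0 iota) -e.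
Qed.

(** A power of the polynomial part of [r] is a multiple of [r], and nonzero polynomials are
    regular. *)
Lemma nonnil_regular (r a : R) : ~ nilpotent_elt r -> r * a = 0 -> a = 0.
Proof.
move=> rn ra; have [p [n pn]] := iota_dec r.
have p0 : p != 0.
  by apply: contra_not_neq rn => p0; exists n; rewrite -pn p0 rmorph0 subr0.
have [c ce] := exprB_multiple (iota p) (iota p - r) n.
apply: (iota_reg (expf_neq0 n p0)); rewrite rmorphXn ce subKr.
by rewrite -opprB exprNn pn mulr0 addr0 -mulrA ra mulr0.
Qed.

(** * Dimension and depth of the localizations *)

Section LocalizedThickening.
Variable P : prime_idealr R.
Local Notation L := (localization P).
Local Notation loc := (loc_map P).

(** If [u a ^+ n = 0] with [u] outside [P], then [u a] is nilpotent. The nilpotents form a prime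
    ideal, and [u] is not among them because [P] contains them all. *)
Lemma loc_nilpotent a : nilpotent_elt (loc a) -> nilpotent_elt a.
Proof.
move=> [n]; rewrite -rmorphXn => /loc_map_eq0 [u uP e].
have [N NE] := nilpotent_prime_ideal.
have : u * a \in N.
  rewrite NE; apply/asboolP; exists n.+1.
  have -> : (u * a) ^+ n.+1 = u ^+ n * a * (u * a ^+ n).
    by rewrite exprMn !exprS; ring.
  by rewrite e mulr0.
rewrite prime_idealrM !NE => /orP[/asboolP[m um]|/asboolP//].
by rewrite (nilpotent_in_prime P um) in uP.
Qed.

Lemma loc_nonnil_regular a x : ~ nilpotent_elt a -> loc a * x = 0 -> x = 0.
Proof.
move=> an ax; have [b [s [sP e]]] := loc_mapP x.
have [y ye] := loc_map_inv sP.
suff b0 : loc b = 0 by rewrite -[x]mul1r -ye -mulrA e b0 mulr0.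
have : loc (a * b) = 0 by rewrite rmorphM /= -e mulrCA ax mulr0.
move/loc_map_eq0 => [u uP ub]; apply/loc_map_eq0; exists u => //.
by apply: (nonnil_regular an); rewrite mulrCA.
Qed.

Lemma loc_nilpotent_prime x y :
  nilpotent_elt (x * y : L) -> nilpotent_elt x \/ nilpotent_elt y.
Proof.
move=> xyn; have [a [s [sP ea]]] := loc_mapP x; have [b [t [tP eb]]] := loc_mapP y.
have [s' se] := loc_map_inv sP; have [t' te] := loc_map_inv tP.
have [N NE] := nilpotent_prime_ideal.
have : a * b \in N.
  rewrite NE; apply/asboolP/loc_nilpotent; rewrite rmorphM /= -ea -eb.
  by rewrite mulrACA; apply: nilpotent_eltM.
have xe : x = s' * loc a by rewrite -ea mulrA se mul1r.
have ye : y = t' * loc b by rewrite -eb mulrA te mul1r.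
have nil_loc c : nilpotent_elt c -> nilpotent_elt (loc c).
  by move=> [n e]; exists n; rewrite -rmorphXn e rmorph0.
rewrite prime_idealrM !NE xe ye.
by case/orP=> /asboolP /nil_loc h; [left|right]; apply: nilpotent_eltM.
Qed.

(** The denominators and the multiplier [u] of [nonnil_prime_power] become units. Both upper bounds,
    for dimension and for depth, rest on this. *)
Lemma loc_prime_power (M : idealr L) x y :
  (forall r, loc r \in M = (r \in P)) ->
  ~ nilpotent_elt x -> x \in M -> y \in M -> exists k c, y ^+ k = c * x.
Proof.
move=> ME xn xM yM.
have [a [s [sP ea]]] := loc_mapP x; have [b [t [tP eb]]] := loc_mapP y.
have aP : a \in P by rewrite -ME -ea idealMr.
have bP : b \in P by rewrite -ME -eb idealMr.
have [s' se] := loc_map_inv sP; have [t' te] := loc_map_inv tP.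
have xe : x = s' * loc a by rewrite -ea mulrA se mul1r.
have ye : y = t' * loc b by rewrite -eb mulrA te mul1r.
have an : ~ nilpotent_elt a.
  move=> [n e]; apply: xn; rewrite xe; apply: nilpotent_eltM.
  by exists n; rewrite -rmorphXn e rmorph0.
have [k [u [c [uP e]]]] := nonnil_prime_power an aP bP.
have [u' ue] := loc_map_inv uP.
exists k, (t' ^+ k * u' * loc (c * s)).
rewrite ye exprMn rmorphM /= -!mulrA ea -rmorphM -e rmorphM rmorphXn /=.
by rewrite !mulrA -[t' ^+ k * u' * _]mulrA ue mulr1.
Qed.

Lemma localization_cohen_macaulay : noetherian R -> maximal_ideal P ->
  local_cohen_macaulay L.
Proof.
move=> Rn Pmax; have [r rP rn] := maximal_nonnil Pmax.
have [M [Mloc ME Munit]] := loc_max_exists P.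
have sub (J : idealr L) : {subset J <= M}.
  move=> x xJ; apply/negPn/negP => /Munit [y yx].
  by have := idealMr y xJ; rewrite yx idealr1.
have genM (s : seq L) : {subset s <= M} -> ideal_gen [set` s] `<=` [set` M].
  move=> sM; apply: ideal_gen_least => //=; first exact: idealr0.
    by move=> a b; apply: rpredD.
  by move=> a b; apply: idealMr.
have rnL : ~ nilpotent_elt (loc r) by move/loc_nilpotent.
exists M; split=> //; first exact: localization_noetherian.
have gen0 x : ideal_gen [set` ([::] : seq L)] x -> x = 0.
  by move/ideal_gen_seq_sum => [c ->]; rewrite big_ord0.
have gen1 a x : ideal_gen [set` ([:: a] : seq L)] x <-> exists c, x = c * a.
  split=> [/ideal_gen_seq_sum [c ->]|[c ->]].
    by exists (c 0%N); rewrite big_ord1.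
  by apply: ideal_genM; apply: ideal_gen_sub; rewrite /= inE.
exists 1%N; split.
(* Dimension at least one: the nilpotents lie strictly below the maximal ideal, which contains
   [loc r]. *)
- have [|||||Q0 Q0E] := @prime_idealr_of_set L [set x | nilpotent_elt x].
  + exact: nilpotent_elt0.
  + by move=> [n /eqP]; rewrite expr1n oner_eq0.
  + exact: nilpotent_eltD.
  + exact: nilpotent_eltM.
  + exact: loc_nilpotent_prime.
  have [|||||Q1 Q1E] := @prime_idealr_of_set L [set` M].
  + exact: idealr0.
  + by rewrite /= idealr1.
  + by move=> a b; apply: rpredD.
  + by move=> a b; apply: idealMr.
  + move=> a b /= abM; have [aM|/Munit [a' ae]] := boolP (a \in M); first by left.
    by right; rewrite -[b]mul1r -ae -mulrA idealMr.
  exists (fun i : 'I_2 => if i == 0 then Q0 else Q1) => i j.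
  case: i j => [[|[|//]] i2] [[|[|//]] j2] //= _; split.
    by move=> x xQ; rewrite Q1E; apply/asboolP; apply: (sub _ _ xQ).
  have rQ : loc r \in Q1 by rewrite Q1E; apply/asboolP; rewrite /= ME.
  by move=> /(_ _ rQ); rewrite Q0E => /asboolP.
(* In a chain of length two take [x] in the second prime but not the first, [y] in the third but not
   the second. As [x] is not nilpotent, a power of [y] is a multiple of [x], so [y] falls into the
   second prime. *)
- move=> n [Q Qch]; rewrite leqNgt; apply/negP => n2.
  have [/= _ /existsNP [x /not_implyP [x1 /negP x0]]] :=
    Qch (inord 0) (inord 1) ltac:(rewrite !inordK //; lia).
  have [/= _ /existsNP [y /not_implyP [y2 /negP y1]]] :=
    Qch (inord 1) (inord 2) ltac:(rewrite !inordK //; lia).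
  have xn : ~ nilpotent_elt x.
    by move=> [m xm]; rewrite (nilpotent_in_prime _ xm) in x0.
  have [k [c e]] := loc_prime_power ME xn (sub _ _ x1) (sub _ _ y2).
  have : y ^+ k \in Q (inord 1) by rewrite e idealMr.
  elim: {e} k => [|k IHk]; first by rewrite expr0 idealr1.
  by rewrite exprS prime_idealrM (negPf y1).
(* Depth at least one: the nonnilpotent [loc r] is regular. *)
- have rM : {subset [:: loc r] <= M} by move=> x; rewrite inE => /eqP ->; rewrite ME.
  exists [:: loc r] => //; split; last by move/(genM _ rM); rewrite /= idealr1.
  case=> // x _ /=; move/gen0/(loc_nonnil_regular rn) => ->.
  exact: ideal_gen0.
(* For a regular sequence starting with [x], [y], some [y ^+ k] is a multiple of [x]; cancelling [y]
   modulo [x] repeatedly puts [1] into the ideal of [x]. *)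
case=> [|x [|y s]] // [sreg sprop] sM; exfalso.
have xM : x \in M by rewrite sM ?inE ?eqxx.
have yM : y \in M by rewrite sM ?inE ?eqxx ?orbT.
have xn : ~ nilpotent_elt x.
  move=> [n]; elim: n => [|n IHn]; first by move/eqP; rewrite oner_eq0.
  rewrite exprS => e; apply: IHn; apply: gen0; apply: (sreg 0%N) => //=.
  by rewrite e; apply: ideal_gen0.
have [k [c e]] := loc_prime_power ME xn xM yM.
have : ideal_gen [set` [:: x]] (y ^+ k) by apply/gen1; exists c.
elim: {e} k => [|k IHk].
  have xsM : {subset [:: x] <= M} by move=> z; rewrite inE => /eqP ->.
  by move/(genM _ xsM); rewrite /= expr0 idealr1.
by rewrite exprS => /(sreg 1%N (y ^+ k) isT) /IHk.
Qed.

End LocalizedThickening.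

Theorem thickening_cohen_macaulay : noetherian R -> cohen_macaulay R.
Proof. by move=> Rn; split=> // P; apply: localization_cohen_macaulay. Qed.

End NilpotentThickening.

(** * Algebras that are finite over [K[t]] are noetherian *)

Section FiniteOverPolynomials.
Variables (K : fieldType) (R : comNzRingType) (iota : {rmorphism {poly K} -> R}).

(** Euclidean division by a nonzero element of least degree. [D] is a plain set because it may be
    all of [K[t]], which no bundled ideal is. *)
Lemma poly_ideal_principal (D : set {poly K}) : D 0 ->
  (forall p q, D p -> D q -> D (p + q)) -> (forall a p, D p -> D (a * p)) ->
  exists2 g, D g & forall p, D p -> g %| p.
Proof.
move=> D0 DD DM; have [[g0 [Dg0 g00]]|Dz] := pselect (exists g, D g /\ g != 0).
  pose S := fun n => `[< exists g, [/\ D g, g != 0 & size g = n] >].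
  have exS : exists n, S n by exists (size g0); apply/asboolP; exists g0.
  case: (ex_minnP exS) => n /asboolP [g [Dg gn0 gn]] nmin.
  exists g => // p Dp; apply/eqP; apply: contrapT => /eqP r0.
  have /nmin : S (size (p %% g)).
    apply/asboolP; exists (p %% g); split=> //.
    have -> : p %% g = p + (- (p %/ g)) * g by rewrite {2}(divp_eq p g); ring.
    by apply: DD => //; apply: DM.
  by rewrite -gn leqNgt ltn_modp gn0.
exists 0 => // p Dp; rewrite dvd0p; apply/eqP; apply: contrapT => /eqP p0.
by apply: Dz; exists p.
Qed.

(** The [K[t]]-submodule spanned by [e], defined by recursion so that one generator can be split
    off. *)
Fixpoint poly_span (e : seq R) : set R :=
  if e is a :: e' then [set x | exists p y, poly_span e' y /\ x = iota p * a + y]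
  else [set 0].

Lemma poly_span0 e : poly_span e 0.
Proof. by elim: e => //= a e IHe; exists 0, 0; rewrite rmorph0 mul0r addr0. Qed.

Lemma poly_spanD e x y : poly_span e x -> poly_span e y -> poly_span e (x + y).
Proof.
elim: e x y => [|a e IHe] x y /=; first by move=> -> ->; rewrite addr0.
move=> [p [x' [sx ->]]] [q [y' [sy ->]]]; exists (p + q), (x' + y').
by split; [apply: IHe | rewrite rmorphD; ring].
Qed.

Lemma poly_spanM e p x : poly_span e x -> poly_span e (iota p * x).
Proof.
elim: e x => [|a e IHe] x /=; first by move=> ->; rewrite mulr0.
move=> [q [x' [sx ->]]]; exists (p * q), (iota p * x').
by split; [apply: IHe | rewrite rmorphM; ring].
Qed.

Lemma poly_span_mem e x : x \in e -> poly_span e x.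
Proof.
elim: e => //= a e IHe; rewrite inE => /orP[/eqP ->|/IHe ex]; last first.
  by exists 0, x; rewrite rmorph0 mul0r add0r.
by exists 1, 0; rewrite rmorph1 mul1r addr0; split=> //; apply: poly_span0.
Qed.

Lemma poly_span_sub e (J : set R) : J 0 -> (forall x y, J x -> J y -> J (x + y)) ->
  (forall p x, J x -> J (iota p * x)) -> (forall x, x \in e -> J x) ->
  poly_span e `<=` J.
Proof.
move=> J0 JD JM; elim: e => [|a e IHe] eJ x /=; first by move=> ->.
move=> [p [y [sy ->]]]; apply: JD; first by apply: JM; apply: eJ; rewrite inE eqxx.
by apply: IHe sy => z ze; apply: eJ; rewrite inE ze orbT.
Qed.

(** The coefficients at the first generator [a] form a principal ideal, generated by some [g]. An
    element of [J] with coefficient [g] at [a], together with generators of the part of [J] in the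
    span of the remaining list, generates [J]. *)
Lemma poly_submodule_fin_gen e (J : set R) : J 0 ->
  (forall x y, J x -> J y -> J (x + y)) -> (forall p x, J x -> J (iota p * x)) ->
  J `<=` poly_span e ->
  exists s : seq R, (forall x, x \in s -> J x) /\ J `<=` poly_span s.
Proof.
elim: e J => [|a e IHe] J J0 JD JM Je; first by exists [::].
pose D := [set p | exists y, poly_span e y /\ J (iota p * a + y)].
have [|||g [y0 [y0e Jg]] gD] := @poly_ideal_principal D.
- by exists 0; rewrite rmorph0 mul0r addr0; split=> //; apply: poly_span0.
- move=> p q [y [ye Jy]] [z [ze Jz]]; exists (y + z).
  split; first exact: poly_spanD.
  have -> : iota (p + q) * a + (y + z) = (iota p * a + y) + (iota q * a + z).
    by rewrite rmorphD; ring.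
  exact: JD.
- move=> b p [y [ye Jy]]; exists (iota b * y); split; first exact: poly_spanM.
  by rewrite rmorphM -mulrA -mulrDr; apply: JM.
have [||||s [sJ Js]] := IHe (J `&` poly_span e).
- by split=> //; apply: poly_span0.
- by move=> x y [? ?] [? ?]; split; [apply: JD | apply: poly_spanD].
- by move=> p x [? ?]; split; [apply: JM | apply: poly_spanM].
- by move=> x [].
exists (iota g * a + y0 :: s); split=> [x|x Jx].
  by rewrite inE => /orP[/eqP -> //|/sJ []].
have [p [y [ye xe]]] := Je _ Jx.
have /gD /dvdpP [q pe] : D p by exists y; rewrite -xe.
exists q, (y - iota q * y0); split; last first.
  by rewrite xe pe rmorphM; ring.
apply: Js; split; last first.
  by apply: poly_spanD => //; rewrite -mulNr -rmorphN; apply: poly_spanM.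
have -> : y - iota q * y0 = x + iota (- q) * (iota g * a + y0).
  by rewrite xe pe rmorphM rmorphN; ring.
by apply: JD => //; apply: JM.
Qed.

Lemma poly_finite_noetherian e : (forall x, poly_span e x) -> noetherian R.
Proof.
move=> espan J.
have [||||s [sJ Js]] := @poly_submodule_fin_gen e [set` J].
- exact: idealr0.
- by move=> x y /=; apply: rpredD.
- by move=> p x; apply: idealMr.
- by move=> x _; apply: espan.
exists s; apply/seteqP; split=> x; last first.
  apply: ideal_gen_least => //=; first exact: idealr0.
    by move=> a b; apply: rpredD.
  by move=> a b; apply: idealMr.
move/Js; apply: poly_span_sub.
- exact: ideal_gen0.
- by move=> a b; apply: ideal_genD.
- by move=> p a; apply: ideal_genM.
by move=> a sa; apply: ideal_gen_sub.
Qed.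

End FiniteOverPolynomials.

(** * Normal monomials *)

Section BresinskyMonomials.

Definition i0 : 'I_4 := @Ordinal 4 0 isT.
Definition i1 : 'I_4 := @Ordinal 4 1 isT.
Definition i2 : 'I_4 := @Ordinal 4 2 isT.
Definition i3 : 'I_4 := @Ordinal 4 3 isT.

Definition mon (a b c d : nat) : 'X_{1..4} :=
  [multinom tnth [tuple a; b; c; d] i | i < 4].

Lemma monE a b c d : (mon a b c d i0 = a) * (mon a b c d i1 = b) *
  (mon a b c d i2 = c) * (mon a b c d i3 = d).
Proof. by rewrite !mnmE. Qed.

Lemma ord4P (P : 'I_4 -> Prop) : P i0 -> P i1 -> P i2 -> P i3 -> forall i, P i.
Proof.
move=> P0 P1 P2 P3 [[|[|[|[|//]]]] lt].
- by rewrite (_ : Ordinal lt = i0) //; apply: val_inj.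
- by rewrite (_ : Ordinal lt = i1) //; apply: val_inj.
- by rewrite (_ : Ordinal lt = i2) //; apply: val_inj.
- by rewrite (_ : Ordinal lt = i3) //; apply: val_inj.
Qed.

Lemma mnm4P (m n : 'X_{1..4}) :
  m i0 = n i0 -> m i1 = n i1 -> m i2 = n i2 -> m i3 = n i3 -> m = n.
Proof. by move=> *; apply/mnmP; apply: ord4P. Qed.

Lemma mdeg4 (m : 'X_{1..4}) : mdeg m = (m i0 + m i1 + m i2 + m i3)%N.
Proof.
rewrite mdegE !big_ord_recl big_ord0 addn0 !addnA.
by congr (m _ + m _ + m _ + m _)%N; apply: val_inj.
Qed.

Variable h : nat.
(** The exponent of [t] in the image of the monomial. *)
Definition mvalue (m : 'X_{1..4}) : nat :=
  (m i0 * ((2 * h - 1) * (2 * h)) + m i1 * ((2 * h - 1) * (2 * h + 1))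
   + m i2 * (2 * h * (2 * h + 1)) + m i3 * (2 * h * (2 * h + 1) + 2 * h - 1))%N.

Lemma mvalueD m n : mvalue (m + n)%MM = (mvalue m + mvalue n)%N.
Proof. by rewrite /mvalue !mnmDE !mulnDl; lia. Qed.

(* [i = 0] gives yz -> xw, [1 <= i <= 2h] the rule for z and w with j = i - 1,
   and [2h+1 <= i < 4h] the rule for y and w with j = i - (2h+1). *)
Definition lead (i : nat) : 'X_{1..4} :=
  if i == 0%N then mon 0 1 1 0
  else if (i <= 2 * h)%N then mon 0 0 (2 * h - i) (i - 1)
  else mon 0 (4 * h + 1 - i) 0 (i - (2 * h + 1)).

Definition tail (i : nat) : 'X_{1..4} :=
  if i == 0%N then mon 1 0 0 1
  else if (i <= 2 * h)%N then mon (2 * h + 2 - i) (i - 1) 0 0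
  else mon (4 * h + 2 - i) 0 (i - (2 * h + 1)) 0.

(** These are the monomials divisible by no [lead i]. *)
Definition normal (m : 'X_{1..4}) : bool :=
  [&& (m i1 == 0%N) || (m i2 == 0%N), (m i2 + m i3 <= 2 * h - 2)%N
    & (m i1 + m i3 <= 2 * h - 1)%N].

Definition standard (m : 'X_{1..4}) : bool := normal m && (m i0 == 0%N).

(** Case analysis by family of rules, with the parameter [j] of the family instead of conditionals
    on the index. *)
Variant lead_spec (i : nat) : 'X_{1..4} -> 'X_{1..4} -> Prop :=
| LeadYZ of i = 0%N : lead_spec i (mon 0 1 1 0) (mon 1 0 0 1)
| LeadZW j of i = j.+1 & (j <= 2 * h - 1)%N :
    lead_spec i (mon 0 0 (2 * h - 1 - j) j) (mon (2 * h + 1 - j) j 0 0)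
| LeadYW j of i = (2 * h + 1 + j)%N & (j <= 2 * h - 2)%N :
    lead_spec i (mon 0 (2 * h - j) 0 j) (mon (2 * h + 1 - j) 0 j 0).

Lemma leadP i : (i < 4 * h)%N -> lead_spec i (lead i) (tail i).
Proof.
rewrite /lead /tail; case: eqP => [->|i_n0] lt; first exact: LeadYZ.
case: leqP => hi.
  have -> : (2 * h - i = 2 * h - 1 - (i - 1))%N by lia.
  have -> : (2 * h + 2 - i = 2 * h + 1 - (i - 1))%N by lia.
  by apply: LeadZW; lia.
have -> : (4 * h + 1 - i = 2 * h - (i - (2 * h + 1)))%N by lia.
have -> : (4 * h + 2 - i = 2 * h + 1 - (i - (2 * h + 1)))%N by lia.
by apply: LeadYW; lia.
Qed.

Lemma lead_i0 i : (i < 4 * h)%N -> lead i i0 = 0%N.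
Proof. by case/leadP => *; rewrite monE. Qed.

Lemma tail_i0 i : (i < 4 * h)%N -> (0 < tail i i0)%N.
Proof. by case/leadP => *; rewrite !monE; lia. Qed.

(** Writing [al] for [2h - 1] removes the truncated subtractions. *)
Lemma mvalueE al m : (2 * h = al.+1)%N ->
  mvalue m = (m i0 * (al * (al + 1)) + m i1 * (al * (al + 2))
    + m i2 * ((al + 1) * (al + 2)) + m i3 * ((al + 1) * (al + 2) + al))%N.
Proof.
move=> e; rewrite /mvalue e -addnBA // subn1 /= -[al.+1]addn1 -!addnA.
by lia.
Qed.

Lemma standard_divisor m n : standard (m + n)%MM -> standard n.
Proof. by rewrite /standard /normal !mnmDE; lia. Qed.

Hypothesis h_ge2 : (2 <= h)%N.

Lemma mvalue_lead i : (i < 4 * h)%N -> mvalue (lead i) = mvalue (tail i).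
Proof.
have [al e] : exists al, (2 * h = al.+1)%N by exists (2 * h).-1; lia.
rewrite !(mvalueE _ e); case/leadP => [_|j _ jh|j _ jh]; rewrite !monE; first by lia.
  have [t te] : exists t, al = (j + t)%N by exists (al - j)%N; lia.
  have -> : (2 * h - 1 - j = t)%N by lia.
  have -> : (2 * h + 1 - j = t + 2)%N by lia.
  by rewrite te; lia.
have [t te] : exists t, al = (j + t)%N by exists (al - j)%N; lia.
have -> : (2 * h - j = t + 1)%N by lia.
have -> : (2 * h + 1 - j = t + 2)%N by lia.
by rewrite te; lia.
Qed.

Lemma mdeg_lead0 : mdeg (lead 0) = mdeg (tail 0).
Proof. by rewrite /lead /tail /= !mdeg4 !monE. Qed.

(** The right-hand sides have degree [2h + 1], the left-hand sides [2h - 1] or [2h]. *)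
Lemma mdeg_lead i : (0 < i < 4 * h)%N -> (mdeg (lead i) < mdeg (tail i))%N.
Proof.
by case/andP=> i_n0 /leadP [e|j _ jh|j _ jh]; rewrite !mdeg4 !monE; lia.
Qed.

Lemma lead_inj i j : (i < 4 * h)%N -> (j < 4 * h)%N -> lead i = lead j -> i = j.
Proof.
move=> lti ltj e.
have := congr1 (fun m : 'X_{1..4} => m i1) e; have := congr1 (fun m : 'X_{1..4} => m i2) e.
have := congr1 (fun m : 'X_{1..4} => m i3) e.
by case: (leadP lti) => [?|? ? ?|? ? ?]; case: (leadP ltj) => [?|? ? ?|? ? ?];
  rewrite !monE; lia.
Qed.

Lemma eq_lead i j : (i < 4 * h)%N -> (j < 4 * h)%N ->
  (lead i == lead j) = (i == j).
Proof. by move=> lti ltj; apply/eqP/eqP => [/lead_inj -> //|->]. Qed.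

Lemma lead_divisor_standard i m n : (i < 4 * h)%N -> (m + n)%MM = lead i ->
  m != 0%MM -> standard n.
Proof.
move=> lti e m0.
have md : (0 < mdeg m)%N by rewrite lt0n mdeg_eq0.
have [e0 e1 e2 e3] : [/\ m i0 + n i0 = lead i i0, m i1 + n i1 = lead i i1,
    m i2 + n i2 = lead i i2 & m i3 + n i3 = lead i i3]%N.
  by rewrite -e !mnmDE.
move: e0 e1 e2 e3; rewrite mdeg4 in md; rewrite /standard /normal.
by case: (leadP lti) => [?|? ? ?|? ? ?]; rewrite !monE; lia.
Qed.

(** The violated condition selects the rule: [yz] first, then the [z], [w] family with [j] the
    exponent of [w] capped at [2h - 1]. If neither applies, the exponent of [w] is at most [2h - 2]
    and serves as [j] in the [y], [w] family. *)
Lemma not_normal_lead m : ~~ normal m ->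
  exists i n, (i < 4 * h)%N /\ m = (lead i + n)%MM.
Proof.
move=> nn.
suff [i [lti l0 l1 [l2 l3]]] : exists i, [/\ (i < 4 * h)%N, (lead i i0 <= m i0)%N,
    (lead i i1 <= m i1)%N & (lead i i2 <= m i2)%N /\ (lead i i3 <= m i3)%N].
  exists i, (mon (m i0 - lead i i0) (m i1 - lead i i1) (m i2 - lead i i2)
                 (m i3 - lead i i3)); split=> //.
  by apply: mnm4P; rewrite mnmDE !monE; lia.
have [yz|] := boolP ((0 < m i1) && (0 < m i2))%N.
  by exists 0%N; rewrite /lead /= !monE; split; lia.
have [zw|] := leqP (2 * h - 1) (m i2 + m i3).
  exists (minn (m i3) (2 * h - 1)).+1.
  have lt : ((minn (m i3) (2 * h - 1)).+1 < 4 * h)%N by lia.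
  by case: (leadP lt) => [?|? ? ?|? ? ?]; rewrite !monE; split; lia.
move=> zw yz; exists (2 * h + 1 + m i3)%N.
have lt : (2 * h + 1 + m i3 < 4 * h)%N by lia.
move: nn; rewrite /normal.
by case: (leadP lt) => [?|? ? ?|? ? ?]; rewrite !monE; split; lia.
Qed.

(** A rule keeps the value and raises the exponent of [x], so their difference decreases. [Q] is
    arbitrary, so one induction serves for values, degrees and membership in an ideal. *)
Lemma normalize (Q : 'X_{1..4} -> 'X_{1..4} -> Prop) :
  (forall m, normal m -> Q m m) ->
  (forall i m n, (i < 4 * h)%N -> Q (tail i + m)%MM n -> Q (lead i + m)%MM n) ->
  forall m, exists2 n, normal n & Q m n.
Proof.
move=> Qnormal Qstep m; have [k] := ubnP (mvalue m - m i0).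
elim: k m => // k IHk m mk.
have [|/not_normal_lead [i [r [lti me]]]] := boolP (normal m).
  by exists m => //; apply: Qnormal.
have [|n n_normal Qn] := IHk (tail i + r)%MM; last first.
  by exists n => //; rewrite me; apply: Qstep.
move: mk; rewrite me !mvalueD mvalue_lead // !mnmDE lead_i0 //.
have := tail_i0 lti.
(* This keeps the truncated difference in the measure exact, so that it drops strictly. *)
have le0 (n : 'X_{1..4}) : (n i0 <= mvalue n)%N.
  by rewrite /mvalue -!addnA (leq_trans _ (leq_addr _ _)) // leq_pmulr //; nia.
have := le0 (tail i); have := le0 r.
by move: (tail i i0) (r i0) (mvalue r) (mvalue (tail i)) => a b c d; lia.
Qed.

(* The value determines [2 (m i2 + m i3)] modulo 2h-1 and [- (m i1 + m i3)]
   modulo 2h, which are both small enough to be read off exactly. *)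
Lemma normal_mvalue_inj m n : normal m -> normal n -> mvalue m = mvalue n -> m = n.
Proof.
have [al e] : exists al, (2 * h = al.+1)%N by exists (2 * h).-1; lia.
rewrite !(mvalueE _ e) => /and3P[m12 mzw myw] /and3P[n12 nzw nyw] mn.
(* The value equals [al * X + 2 (m i2 + m i3)] and also [(al + 1) * Y - (m i1 + m i3)]; [eX] and
   [eY] compare these for [m] and [n]. *)
pose X (m : 'X_{1..4}) := (m i0 * (al + 1) + m i1 * (al + 2)
  + (m i2 + m i3) * (al + 3) + m i3)%N.
pose Y (m : 'X_{1..4}) := (m i0 * al + m i1 * (al + 1)
  + m i2 * (al + 2) + m i3 * (al + 3))%N.
have eX : (al * X m + 2 * (m i2 + m i3) = al * X n + 2 * (n i2 + n i3))%N.
  by move: mn; rewrite /X; lia.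
have eY : ((al + 1) * Y m + (n i1 + n i3) = (al + 1) * Y n + (m i1 + m i3))%N.
  by move: mn; rewrite /Y; lia.
have zw : (m i2 + m i3 = n i2 + n i3)%N.
  have lim (p q x y : nat) : (p < al)%N -> (q < al)%N ->
      (al * x + 2 * p = al * y + 2 * q)%N -> (p <= q)%N.
    move=> pl ql; rewrite leqNgt => exy; apply/negP => lt.
    have xy : (x < y)%N by rewrite -(@ltn_pmul2l al); lia.
    (* If [y = x + 1], then [al] would be even, against [2 * h = al.+1]; a larger gap is excluded by
       the bound on [p]. *)
    have [|y1] := leqP y x.+1; first by move=> yx; have ye : y = x.+1 by [lia];
      move: exy; rewrite ye mulnS; lia.
    by have := leq_mul (leqnn al) y1; rewrite !mulnS; lia.
  by apply/eqP; rewrite eqn_leq; apply/andP; split;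
    [apply: lim eX | apply: lim (esym eX)]; lia.
have yw : (m i1 + m i3 = n i1 + n i3)%N.
  have lim (p q x y : nat) : (p <= al)%N -> (q <= al)%N ->
      ((al + 1) * x + q = (al + 1) * y + p)%N -> (p <= q)%N.
    move=> pl ql exy; rewrite leqNgt; apply/negP => lt.
    have : (y < x)%N by rewrite -(@ltn_pmul2l (al + 1)); lia.
    by move/(leq_mul (leqnn (al + 1))); rewrite mulnS; lia.
  by apply/eqP; rewrite eqn_leq; apply/andP; split;
    [apply: lim eY | apply: lim (esym eY)]; lia.
(* By [zw] and [yw], [m i1 - m i2 = n i1 - n i2], and on each side one of the two exponents is
   zero. *)
have e1 : m i1 = n i1 by case/orP: m12 => /eqP; case/orP: n12 => /eqP; lia.
have e3 : m i3 = n i3 by lia.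
have e2 : m i2 = n i2 by lia.
apply: mnm4P => //; move: mn; rewrite e1 e2 e3 => /eqP.
by rewrite !eqn_add2r eqn_pmul2r ?muln_gt0; [move/eqP | lia].
Qed.

(** The normal monomial reached from [m] has the value of [n], hence is [n]. *)
Lemma reduce_to_normal (Q : 'X_{1..4} -> 'X_{1..4} -> Prop) :
  (forall m, normal m -> Q m m) ->
  (forall i m n, (i < 4 * h)%N -> Q (tail i + m)%MM n -> Q (lead i + m)%MM n) ->
  forall m n, normal n -> mvalue m = mvalue n -> Q m n.
Proof.
move=> Qnormal Qstep m n n_normal e.
have [||k k_normal [ek Qmk]] := @normalize (fun m k => mvalue m = mvalue k /\ Q m k) _ _ m.
- by move=> k k_normal; split=> //; apply: Qnormal.
- move=> i r k lti [ek Qk]; split; last exact: Qstep.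
  by rewrite mvalueD mvalue_lead // -mvalueD.
by rewrite -(normal_mvalue_inj k_normal n_normal) // -ek.
Qed.

(** The normal form is chosen as a function of the value alone, so that monomials with the same
    image share it and [sum_powX_transfer] applies. *)
Lemma normal_form_fun : exists nf : nat -> 'X_{1..4}, forall m,
  normal (nf (mvalue m)) /\ mvalue m = mvalue (nf (mvalue m)).
Proof.
have : forall v, exists n, forall m, mvalue m = v -> normal n /\ mvalue n = v.
  move=> v; have [[m mv]|no] := pselect (exists m, mvalue m = v); last first.
    (* An arbitrary default for numbers that are not values. *)
    by exists 0%MM => m mv; case: no; exists m.
  have [||n n_normal mn] := @normalize (fun m k => mvalue m = mvalue k) _ _ m => //.
    by move=> i r k lti; rewrite !mvalueD mvalue_lead.
  by exists n => m' _; split=> //; rewrite -mn.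
by move=> /choice [nf nfP]; exists nf => m; have [? ?] := nfP _ m erefl.
Qed.

(* Any other monomial of the same value would reduce to a normal monomial
   divisible by the first variable. *)
Lemma standard_mvalue_uniq m n : standard n -> mvalue m = mvalue n -> m = n.
Proof.
move=> /andP[n_normal /eqP n0] e.
case: (reduce_to_normal (Q := fun m k => m = k \/ 0 < k i0)%N _ _ _ _ n_normal e) => //.
- by move=> k _; left.
- move=> i r k lti kP; right; case: kP => // <-.
  by rewrite mnmDE; have := tail_i0 lti; lia.
by rewrite n0.
Qed.

(* Reducing a multiple of the first variable x never removes the factor x, and
   the value of a product by x determines its normal form. *)
Lemma cancel_x m n : mvalue n = (mvalue m + mvalue (mon 1 0 0 0))%N ->
  exists k, mvalue k = mvalue m /\ (mdeg n <= mdeg k + 1)%N.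
Proof.
move=> e; have [nf nfP] := normal_form_fun.
have [k_normal ek] := nfP m; exists (nf (mvalue m)); split=> //.
set k := nf _ in k_normal ek *.
have xk_normal : normal (mon 1 0 0 0 + k)%MM.
  by move: k_normal; rewrite /normal !mnmDE !monE.
have exk : mvalue n = mvalue (mon 1 0 0 0 + k)%MM by rewrite mvalueD e -ek addnC.
have := reduce_to_normal (Q := fun m k => mdeg m <= mdeg k)%N _ _ _ _ xk_normal exk.
have -> : mdeg (mon 1 0 0 0 + k)%MM = (mdeg k + 1)%N.
  by rewrite mdegD !mdeg4 !monE; lia.
apply=> // i r s lti; apply: leq_trans; rewrite !mdegD leq_add2r.
case: i lti => [|i] lti; first by rewrite mdeg_lead0.
by apply: ltnW; apply: mdeg_lead.
Qed.

End BresinskyMonomials.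

(** * Generators of the toric ideal and of its initial ideal *)

Section MonomialSums.
Variable K : fieldType.

(** The powers of ['X] are linearly independent, so a relation among them survives the linear map
    sending ['X^k] to [F k]. *)
Lemma sum_powX_transfer (T : eqType) (V : lmodType K) (s : seq T) (c : T -> K)
    (v : T -> nat) (F : nat -> V) :
  \sum_(m <- s) c m *: 'X^(v m) = 0 :> {poly K} ->
  \sum_(m <- s) c m *: F (v m) = 0.
Proof.
move=> e; pose N := (\max_(m <- s) v m).+1.
have -> : \sum_(m <- s) c m *: F (v m) =
    \sum_(k < N) (\sum_(m <- s) c m *: 'X^(v m))`_k *: F k.
  rewrite [RHS](eq_bigr (fun k : 'I_N =>
      \sum_(m <- s) (c m * (k == v m :> nat)%:R) *: F k)); last first.
    move=> k _; rewrite coef_sum scaler_suml; apply: eq_bigr => m _.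
    by rewrite coefZ coefXn.
  rewrite exchange_big /= big_seq [RHS]big_seq; apply: eq_bigr => m ms.
  have lt : (v m < N)%N by rewrite ltnS; exact: leq_bigmax_seq.
  rewrite (bigD1 (Ordinal lt)) //= eqxx mulr1 big1 ?addr0 // => k kne.
  by rewrite (negPf (_ : k != v m :> nat)) ?mulr0 ?scale0r.
by rewrite e; apply: big1 => k _; rewrite coef0 scale0r.
Qed.

Lemma mcoeff_sum n (f : {mpoly K[n]}) m :
  f@_m = \sum_(k <- msupp f) f@_k * (k == m)%:R.
Proof.
rewrite {1}[f]mpolyE raddf_sum; apply: eq_bigr => k _ /=.
by rewrite mcoeffZ mcoeffX.
Qed.

End MonomialSums.

Section Ideals.
Variables (K : fieldType) (h : nat) (h_ge2 : (2 <= h)%N).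
Local Notation S := {mpoly K[4]}.
Local Notation B := (bresinsky h_ge2).
Local Notation val_map :=
  (mmap (@polyC K) (fun i : 'I_4 => 'X^(tnth (mingens B) i))).

Lemma val_mapX m : val_map 'X_[m] = 'X^(mvalue h m) :> {poly K}.
Proof.
rewrite mmapX /mmap1 !big_ord_recl big_ord0 mulr1 -!exprM -!exprD; congr ('X^_).
rewrite /mvalue (_ : lift ord0 (lift ord0 (lift ord0 ord0)) = i3); last exact: val_inj.
rewrite (_ : lift ord0 (lift ord0 ord0) = i2); last exact: val_inj.
rewrite (_ : lift ord0 ord0 = i1); last exact: val_inj.
rewrite (_ : ord0 = i0); last exact: val_inj.
by rewrite /tnth /=; lia.
Qed.

Lemma val_mapE (f : S) : val_map f = \sum_(m <- msupp f) f@_m *: 'X^(mvalue h m).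
Proof.
rewrite {1}[f]mpolyE raddf_sum; apply: eq_bigr => m _ /=.
by rewrite mmapZ val_mapX mul_polyC.
Qed.

Definition toric_gen i : S := 'X_[lead h i] - 'X_[tail h i].
Definition initial_gen i : S := if i == 0%N then toric_gen 0 else 'X_[lead h i].

Definition no_standard : set S := [set f | forall m, standard h m -> f@_m = 0].

(** No other monomial shares the value of a standard one, so its coefficient in [f] is a coefficient
    of the image of [f]. *)
Lemma toric_no_standard : toric_ideal K B `<=` no_standard.
Proof.
move=> f /= f0 n n_std.
have : (val_map f)`_(mvalue h n) = 0 by rewrite f0 coef0.
rewrite val_mapE coef_sum => <-; rewrite mcoeff_sum.
apply: eq_bigr => m _; rewrite coefZ coefXn.
rewrite (_ : (m == n) = (mvalue h n == mvalue h m)) //.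
by apply/eqP/eqP => [->//|e]; apply: (standard_mvalue_uniq h_ge2).
Qed.

(** In the convolution every other term pairs a nonconstant monomial of [c] with a proper divisor of
    [lead h i], which is standard and so has coefficient zero in [f]. *)
Lemma mcoeffM_lead (c f : S) i : (i < 4 * h)%N -> no_standard f ->
  (c * f)@_(lead h i) = c@_0%MM * f@_(lead h i).
Proof.
move=> lti f0; rewrite mcoeffM.
have b0 : (mdeg (0 : 'X_{1..4})%MM < (mdeg (lead h i)).+1)%N by rewrite mdeg0.
have b1 : (mdeg (lead h i) < (mdeg (lead h i)).+1)%N by [].
rewrite (bigD1 (BMultinom b0, BMultinom b1)) /=; last by rewrite add0m.
rewrite big1 ?addr0 // => -[[m bm] [n bn]] /= /andP[/eqP e ne].
have m0 : m != 0%MM.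
  apply: contraNneq ne => m0; rewrite m0 add0m in e.
  by apply/eqP; congr (_, _); apply: val_inj => /=.
by rewrite f0 ?mulr0 //; apply: lead_divisor_standard (esym e) m0.
Qed.

(** By [mcoeffM_lead], each unit vector of length [4h] is a combination of the rows of [A], the
    combination using only constant terms. So [A] has rank [4h] and at least as many rows. *)
Lemma no_standard_min_gens (J : set S) (g : nat -> S) (s : seq S) :
  J `<=` no_standard -> (forall i, (i < 4 * h)%N -> J (g i)) ->
  (forall i j, (i < 4 * h)%N -> (j < 4 * h)%N ->
     (g i)@_(lead h j) = (i == j)%:R) ->
  J = ideal_gen [set` s] -> (4 * h <= size s)%N.
Proof.
move=> Jstd Jg gE Js.
pose A := \matrix_(k < size s, j < 4 * h) (s`_k)@_(lead h j).
suff sub : ((1%:M : 'M[K]_(4 * h)) <= A)%MS.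
  by have := leq_trans (mxrankS sub) (rank_leq_row A); rewrite mxrank1.
apply/row_subP => i.
have : J (g i) by apply: Jg.
rewrite Js => /ideal_gen_seq_sum [c ce].
have -> : row i 1%:M = (\row_(k < size s) (c k)@_0%MM) *m A; last exact: submxMl.
apply/rowP => j; transitivity ((g i)@_(lead h j)); first by rewrite !mxE gE.
rewrite !mxE ce raddf_sum.
apply: eq_bigr => k _ /=; rewrite !mxE mcoeffM_lead //.
by apply: Jstd; rewrite Js; apply: ideal_gen_sub => /=; apply: mem_nth.
Qed.

Definition ideal_set (G : set S) : Prop :=
  [/\ G 0, forall x y, G x -> G y -> G (x + y) & forall a x, G x -> G (a * x)].

Lemma ideal_set_gen (A : set S) : ideal_set (ideal_gen A).
Proof.
split; [exact: ideal_gen0 | exact: ideal_genD | exact: ideal_genM].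
Qed.

Lemma no_standard_ideal : ideal_set no_standard.
Proof.
split=> [m _|x y x0 y0 m m_std|a x x0 m m_std]; first by rewrite mcoeff0.
  by rewrite mcoeffD x0 // y0 // addr0.
rewrite mcoeffM big1 // => -[k l] /= /eqP e; rewrite x0 ?mulr0 //.
by apply: (standard_divisor (h := h) (m := bmnm k)); rewrite -e.
Qed.

Lemma toric_ideal_set : ideal_set (toric_ideal K B).
Proof.
split=> [|x y x0 y0|a x x0]; first exact: (rmorph0 val_map).
  by rewrite /toric_ideal /= -[mmap _ _ _]/(val_map (x + y)) raddfD /= x0 y0 addr0.
by rewrite /toric_ideal /= -[mmap _ _ _]/(val_map (a * x)) rmorphM /= x0 mulr0.
Qed.

Lemma toric_gen_toric i : (i < 4 * h)%N -> toric_ideal K B (toric_gen i).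
Proof.
move=> lti; rewrite /toric_ideal /= -[mmap _ _ _]/(val_map (toric_gen i)) raddfB /= !val_mapX.
by rewrite mvalue_lead // subrr.
Qed.

Lemma mcoeff_toric_gen i j : (i < 4 * h)%N -> (j < 4 * h)%N ->
  (toric_gen i)@_(lead h j) = (i == j)%:R.
Proof.
move=> lti ltj; rewrite mcoeffB !mcoeffX.
have -> : (tail h i == lead h j) = false.
  by apply/eqP => e; have := tail_i0 lti; rewrite e lead_i0.
by rewrite subr0; rewrite (eq_lead h_ge2).
Qed.

Lemma mcoeff_initial_gen i j : (i < 4 * h)%N -> (j < 4 * h)%N ->
  (initial_gen i)@_(lead h j) = (i == j)%:R.
Proof.
rewrite /initial_gen; case: eqP => [->|_] lti ltj; first exact: mcoeff_toric_gen.
by rewrite mcoeffX; rewrite (eq_lead h_ge2).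
Qed.

Lemma ideal_set_sum (G : set S) (I : eqType) (r : seq I) (c : I -> K) (F : I -> S) :
  ideal_set G -> (forall i, i \in r -> G (F i)) -> G (\sum_(i <- r) c i *: F i).
Proof.
move=> [G0 GD GM] GF; rewrite big_seq; apply: (big_ind G) => // i ir.
by rewrite -mul_mpolyC; apply/GM/GF.
Qed.

(** For [f] in the kernel the normal forms of its terms cancel, so [f] is a combination of
    differences between a monomial and its normal form; each rewriting step adds a multiple of a
    generator. *)
Lemma toric_ideal_gen :
  toric_ideal K B = ideal_gen [set` mkseq toric_gen (4 * h)].
Proof.
have [T0 TD TM] := toric_ideal_set.
set G := ideal_gen _; have [G0 GD GM] : ideal_set G := ideal_set_gen _.
have Gb i : (i < 4 * h)%N -> G (toric_gen i).
  move=> lti; apply: ideal_gen_sub => /=; apply/mapP; exists i => //.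
  by rewrite mem_iota.
apply/seteqP; split=> [f f0|]; last first.
  apply: ideal_gen_least => // f /= /mapP [i]; rewrite mem_iota => lti ->.
  exact: toric_gen_toric.
have [nf nfP] := normal_form_fun h_ge2.
have f_nf : \sum_(m <- msupp f) f@_m *: ('X_[nf (mvalue h m)] : S) = 0.
  by apply: (sum_powX_transfer (fun v => 'X_[nf v])); rewrite -val_mapE.
have -> : f = \sum_(m <- msupp f) f@_m *: ('X_[m] - 'X_[nf (mvalue h m)]).
  under eq_bigr do rewrite scalerBr.
  by rewrite sumrB f_nf subr0 -mpolyE.
apply: ideal_set_sum => // m _; have [n_normal e] := nfP m.
apply: (reduce_to_normal h_ge2 (Q := fun m n => G ('X_[m] - 'X_[n])) _ _ n_normal e).
  by move=> k _; rewrite subrr.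
move=> i r k lti Gk; have -> : 'X_[lead h i + r] - 'X_[k] =
    'X_[r] * toric_gen i + ('X_[tail h i + r] - 'X_[k]) :> S.
  by rewrite /toric_gen !mpolyXD; ring.
by apply: GD => //; apply/GM/Gb.
Qed.

Lemma num_gens_toric : num_gens (toric_ideal K B) (4 * h).
Proof.
split=> [|s e].
  by exists (mkseq toric_gen (4 * h)); rewrite ?size_mkseq -?toric_ideal_gen.
apply: (no_standard_min_gens toric_no_standard _ _ e (g := toric_gen)).
  exact: toric_gen_toric.
exact: mcoeff_toric_gen.
Qed.

(** * Initial forms and generators of the initial ideal *)

Lemma mcoeff_pihomog d (f : S) m :
  (pihomog mdeg d f)@_m = if mdeg m == d then f@_m else 0.
Proof.
rewrite pihomogE raddf_sum /= mcoeff_sum big_mkcond /=.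
case: ifP => md.
  apply: eq_bigr => k _; case: ifP => kd; first by rewrite mcoeffZ mcoeffX.
  by case: eqP => [e|_]; [rewrite -e kd in md | rewrite mulr0].
apply: big1 => k _; case: ifP => // kd; rewrite mcoeffZ mcoeffX.
by case: eqP => [e|_]; [rewrite e md in kd | rewrite mulr0].
Qed.

Lemma pihomog_mdegX d m :
  pihomog mdeg d ('X_[m] : S) = if mdeg m == d then 'X_[m] else 0.
Proof. exact: pihomogX. Qed.

Lemma pihomog_mdegE d (f : S) :
  pihomog mdeg d f = \sum_(m <- msupp f | mdeg m == d) f@_m *: 'X_[m].
Proof. by []. Qed.

(** The binomial of index [0] is homogeneous; in the others the tail has larger degree and drops
    out. *)
Lemma initial_form_toric_gen i : (i < 4 * h)%N -> initial_form (toric_gen i) (initial_gen i).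
Proof.
move=> lti; exists (mdeg (lead h i)); split; last 2 first.
- apply/eqP => /(congr1 (mcoeff (lead h i))) /eqP.
  by rewrite mcoeff_initial_gen // eqxx mcoeff0 oner_eq0.
- move=> e elt; rewrite pihomogB !pihomog_mdegX gtn_eqF // sub0r gtn_eqF ?oppr0 //.
  case: i lti elt => [|i] lti elt; first by rewrite -mdeg_lead0.
  by apply: ltn_trans elt _; apply: mdeg_lead.
rewrite pihomogB !pihomog_mdegX eqxx /initial_gen; case: eqP => [->|/eqP i_n0].
  by rewrite mdeg_lead0 eqxx.
by rewrite gtn_eqF ?subr0 // mdeg_lead // lt0n i_n0.
Qed.

Lemma initial_ideal_gen :
  initial_ideal (toric_ideal K B) = ideal_gen [set` mkseq initial_gen (4 * h)].
Proof.
set G := ideal_gen [set` _]; have [G0 GD GM] : ideal_set G := ideal_set_gen _.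
have Gi i : (i < 4 * h)%N -> G (initial_gen i).
  move=> lti; apply: ideal_gen_sub => /=; apply/mapP; exists i => //.
  by rewrite mem_iota.
have h0 : (0 < 4 * h)%N by lia.
apply/seteqP; split; last first.
  have [I0 ID IM] := ideal_set_gen [set g | exists2 f, toric_ideal K B f /\ f != 0
      & initial_form f g].
  apply: ideal_gen_least => // g /= /mapP [i]; rewrite mem_iota => lti ->.
  apply: ideal_gen_sub; exists (toric_gen i); last exact: initial_form_toric_gen.
  split; first exact: toric_gen_toric.
  apply/eqP => /(congr1 (mcoeff (lead h i))) /eqP.
  by rewrite mcoeff_toric_gen // eqxx mcoeff0 oner_eq0.
apply: ideal_gen_least => // _ /= [f [f0 _] [d [-> _ flow]]].
have fd m : m \in msupp f -> (d <= mdeg m)%N.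
  rewrite mcoeff_msupp leqNgt; apply: contra => /flow.
  by move/(congr1 (mcoeff m)); rewrite mcoeff_pihomog eqxx mcoeff0 => ->.
have [nf nfP] := normal_form_fun h_ge2.
(* Only normal forms of degree [d] are kept, and their weighted sum still cancels; subtracting it
   leaves the degree [d] component unchanged. *)
pose F v : S := if mdeg (nf v) == d then 'X_[nf v] else 0.
have f_nf : \sum_(m <- msupp f) f@_m *: F (mvalue h m) = 0.
  by apply: (sum_powX_transfer F); rewrite -val_mapE.
have -> : pihomog mdeg d f = \sum_(m <- msupp f)
    f@_m *: ((if mdeg m == d then 'X_[m] else 0) - F (mvalue h m)).
  under eq_bigr do rewrite scalerBr.
  rewrite sumrB f_nf subr0 pihomog_mdegE big_mkcond; apply: eq_bigr => m _.
  by case: ifP; rewrite ?scaler0.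
apply: ideal_set_sum => // m /fd dm; have [n_normal e] := nfP m.
(* If the degree never rises, only the homogeneous rule was used and the difference lies in [G]; if
   it rises, some other rule was used and the monomial itself lies in [G]. *)
have [] := reduce_to_normal h_ge2 (Q := fun m n => [/\ (mdeg m <= mdeg n)%N,
    mdeg m = mdeg n -> G ('X_[m] - 'X_[n]) &
    (mdeg m < mdeg n)%N -> G 'X_[m]]) _ _ n_normal e.
- by move=> k _; rewrite subrr ltnn.
- move=> i r k lti; rewrite !mdegD; case: i lti => [|i] lti [le Geq Glt].
    have e0 : 'X_[lead h 0 + r] = 'X_[r] * toric_gen 0 + 'X_[tail h 0 + r] :> S.
      by rewrite /toric_gen !mpolyXD; ring.
    rewrite mdeg_lead0; split=> // hd; rewrite e0 -?addrA; apply: GD.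
    + by apply/GM/(Gi 0%N).
    + exact: Geq.
    + by apply/GM/(Gi 0%N).
    + exact: Glt.
  have lt := mdeg_lead h_ge2 (i := i.+1) lti.
  split; [lia | lia | move=> _].
  by rewrite mpolyXD mulrC; apply/GM/(Gi i.+1).
(* Terms of degree above [d] have normal forms above [d] and contribute nothing; those of degree [d]
   fall under one of the two alternatives. *)
rewrite /F; move: (nf _) => n; case: (ltngtP d (mdeg m)) dm => // [dm _|<- _].
  by move=> le _ _; rewrite (gtn_eqF (leq_trans dm le)) subr0.
rewrite leq_eqVlt => /orP[/eqP e' /(_ e')|lt _ /(_ lt)]; first by rewrite -e' eqxx.
by rewrite gtn_eqF // subr0.
Qed.

Lemma num_gens_initial : num_gens (initial_ideal (toric_ideal K B)) (4 * h).
Proof.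
split=> [|s e].
  by exists (mkseq initial_gen (4 * h)); rewrite ?size_mkseq -?initial_ideal_gen.
apply: (no_standard_min_gens _ _ _ e (g := initial_gen)).
- have [N0 ND NM] := no_standard_ideal.
  apply: ideal_gen_least => // _ /= [f [f0 _] [d [-> _ _]]] m m_std.
  by rewrite mcoeff_pihomog (toric_no_standard f0) // if_same.
- move=> i lti; rewrite initial_ideal_gen; apply: ideal_gen_sub => /=.
  by apply/mapP; exists i => //; rewrite mem_iota.
exact: mcoeff_initial_gen.
Qed.

End Ideals.

(** * The tangent cone *)

Section TangentCone.
Variables (K : fieldType) (h : nat) (h_ge2 : (2 <= h)%N).
Local Notation B := (bresinsky h_ge2).
Local Notation A := (semigroup_ring K B).
Local Notation I := (@semigroup_ring_max K B).
Local Notation sval := (@semigroup_ring_val K B).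

(** * Powers of the maximal ideal read off from exponents *)

Definition has_order i v := exists2 m, mvalue h m = v & (i <= mdeg m)%N.

Definition order_ge i (p : {poly K}) := forall k, p`_k != 0 -> has_order i k.

Lemma order_ge_zero i : order_ge i 0.
Proof. by move=> k; rewrite coef0 eqxx. Qed.

Lemma order_geD i p q : order_ge i p -> order_ge i q -> order_ge i (p + q).
Proof.
move=> ip iq k; rewrite coefD; have [p0|pk] := eqVneq p`_k 0.
  by rewrite p0 add0r => /iq.
by move=> _; apply: ip.
Qed.

Lemma order_geZ i a p : order_ge i p -> order_ge i (a *: p).
Proof. by move=> ip k; rewrite coefZ mulf_eq0 negb_or => /andP[_ /ip]. Qed.

Lemma order_geM i j p q : order_ge i p -> order_ge j q -> order_ge (i + j) (p * q).
Proof.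
move=> ip jq k; rewrite coefM => s0.
have [l] : exists l : 'I_k.+1, p`_l * q`_(k - l) != 0.
  apply: contrapT => no; move/eqP: s0; apply; apply: big1 => l _.
  by apply/eqP; apply: contrapT => /negP l0; apply: no; exists l.
rewrite mulf_eq0 negb_or => /andP[/ip [m mv im] /jq [n nv jn]].
exists (m + n)%MM; last by rewrite mdegD leq_add.
by rewrite mvalueD mv nv subnKC // -ltnS.
Qed.

Lemma order_geX m : order_ge (mdeg m) 'X^(mvalue h m).
Proof.
move=> k; rewrite coefXn; have [->|_] := eqVneq k (mvalue h m); first by exists m.
by rewrite eqxx.
Qed.

Lemma order_geW i j p : (i <= j)%N -> order_ge j p -> order_ge i p.
Proof. by move=> ij jp k /jp [m mv jm]; exists m => //; apply: leq_trans jm. Qed.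

Lemma mvalue0 : mvalue h 0%MM = 0%N.
Proof. by rewrite /mvalue !mnm0E. Qed.

Lemma order_ge_one : order_ge 0 (1 : {poly K}).
Proof. by have := @order_geX 0%MM; rewrite mvalue0 expr0 mdeg0. Qed.

Lemma mvalueU (i : 'I_4) : mvalue h U_(i)%MM = tnth (mingens B) i.
Proof.
have mU (j : 'I_4) : U_(i)%MM j = (i == j) :> nat by rewrite mnm1E.
rewrite /mvalue !mU; move: i {mU}; apply: ord4P; rewrite /tnth /=; lia.
Qed.

(** The polynomials satisfying [order_ge 0] form a subalgebra containing the generators, and the
    semigroup ring lies in every such subalgebra. *)
Lemma semigroup_ring_order (p : A) : order_ge 0 (sval p).
Proof.
case: p => p /= /asboolP /(_ (fun q => `[< order_ge 0 q >])) H.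
apply/asboolP; apply: H => [|i]; last first.
  apply/asboolP; rewrite -mvalueU; apply: order_geW (@order_geX _); exact: leq0n.
split; first by apply/asboolP; apply: order_ge_one.
  move=> a u v /asboolP u0 /asboolP v0; apply/asboolP; apply: order_geD => //.
  exact: order_geZ.
by move=> u v /asboolP u0 /asboolP v0; apply/asboolP/(order_geM (i := 0) (j := 0)).
Qed.

Lemma svalM (p q : A) : sval (p * q) = sval p * sval q. Proof. by []. Qed.
Lemma svalD (p q : A) : sval (p + q) = sval p + sval q. Proof. by []. Qed.
Lemma sval0 : sval 0 = 0. Proof. by []. Qed.
Lemma sval1 : sval 1 = 1. Proof. by []. Qed.
Lemma svalX (p : A) n : sval (p ^+ n) = sval p ^+ n.
Proof. by elim: n => // n IHn; rewrite !exprS svalM IHn. Qed.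

Lemma sconst_proof (c : K) : c%:P \in @semigroup_ring_pred K B.
Proof.
apply/asboolP => S [S1 SZ _] _.
by rewrite -[c](subrK 1) polyCD -alg_polyC; apply: SZ.
Qed.

Definition sconst (c : K) : A := SemigroupRing (sconst_proof c).

Lemma sconst_is_zmod : zmod_morphism sconst.
Proof. by move=> c d; apply: val_inj; rewrite /= polyCB. Qed.

Lemma sconst_is_monoid : monoid_morphism sconst.
Proof. by split=> [|c d]; apply: val_inj; rewrite //= polyCM. Qed.

HB.instance Definition _ := GRing.isZmodMorphism.Build K A sconst sconst_is_zmod.
HB.instance Definition _ :=
  GRing.isMonoidMorphism.Build K A sconst sconst_is_monoid.

Lemma svar_proof (i : 'I_4) :
  'X^(tnth (mingens B) i) \in @semigroup_ring_pred K B.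
Proof. by apply/asboolP => S _; apply. Qed.

Definition svar (i : 'I_4) : A := SemigroupRing (svar_proof i).

Definition smon (m : 'X_{1..4}) : A := mmap1 svar m.

Lemma sval_smon m : sval (smon m) = 'X^(mvalue h m).
Proof.
rewrite -[RHS](val_mapX K h_ge2) mmapX /smon /mmap1 (big_morph sval svalM sval1).
by apply: eq_bigr => i _; rewrite svalX.
Qed.

Lemma smonD m n : smon (m + n)%MM = smon m * smon n.
Proof. by apply: val_inj; rewrite /= !sval_smon mvalueD exprD. Qed.

(** Each exponent in the support is lifted separately to a monomial of degree at least [i]. *)
Lemma semigroup_ring_decomp i (p : A) : order_ge i (sval p) ->
  exists2 s : seq (K * 'X_{1..4}), p = \sum_(t <- s) sconst t.1 * smon t.2 &
    forall t, t \in s -> (i <= mdeg t.2)%N.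
Proof.
move=> ip.
have /choice [f fP] : forall k, exists m, (sval p)`_k != 0 ->
    mvalue h m = k /\ (i <= mdeg m)%N.
  move=> k; have [pk|/ip [m mk im]] := eqVneq (sval p)`_k 0; last by exists m.
  by exists 0%MM.
exists [seq ((sval p)`_k, f k) | k <- index_iota 0 (size (sval p)) & (sval p)`_k != 0].
  rewrite big_map big_filter; apply: val_inj => /=.
  rewrite (big_morph sval svalD sval0) -{1}[sval p]coefK poly_def.
  rewrite big_mkord [RHS]big_mkcond /=; apply: eq_bigr => k _.
  case: eqP => [->|/eqP /fP [mk _]]; first by rewrite scale0r.
  by rewrite sval_smon mk mul_polyC.
by move=> t /mapP [k]; rewrite mem_filter => /andP[/fP[_ ?] _] ->.
Qed.

Lemma svar_max i : svar i \in I.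
Proof. by apply/asboolP/ideal_gen_sub; exists i. Qed.

Lemma ideal_powW i j (p : A) : (i <= j)%N -> ideal_pow I j p -> ideal_pow I i p.
Proof.
move/subnK <-; elim: (j - i)%N => [|k IHk]; first by rewrite add0n.
by rewrite addSn => /(@ideal_powS _ I).
Qed.

Lemma ideal_pow_smon m : ideal_pow I (mdeg m) (smon m).
Proof.
rewrite mdegE /smon /mmap1.
apply: (big_ind2 (fun n p => ideal_pow I n p)) => //.
  by move=> i p j q; apply: ideal_pow_mul.
move=> i _; elim: (m i) => [|k IHk] //=.
by apply: ideal_gen_sub; exists (svar i), (svar i ^+ k); rewrite svar_max exprS.
Qed.

(** One direction is induction on [i], as orders add up in products; for the other, a lifted
    monomial of degree at least [i] is a product of that many generators. *)
Lemma ideal_powE i (p : A) : ideal_pow I i p <-> order_ge i (sval p).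
Proof.
split; last first.
  move/semigroup_ring_decomp => [s -> sP]; rewrite big_seq.
  apply: (big_ind (ideal_pow I i)); first exact: ideal_pow_gen0.
    by move=> *; apply: ideal_powD.
  by move=> t /sP it; apply: ideal_powM; apply: ideal_powW it (ideal_pow_smon _).
have ordM j (a x : A) : order_ge j (sval x) -> order_ge j (sval (a * x)).
  by move=> jx; apply: (@order_geM 0) => //; apply: semigroup_ring_order.
elim: i p => [|i IHi] p; first by move=> _; apply: semigroup_ring_order.
apply: (@ideal_gen_least _ _ (fun p => order_ge i.+1 (sval p))).
- exact: order_ge_zero.
- by move=> x y; apply: order_geD.
- by move=> a x; apply: ordM.
move=> _ [x [y [/asboolP xI /IHi iy ->]]].
apply: (@order_geM 1) iy.
move: xI; apply: (@ideal_gen_least _ _ (fun p => order_ge 1 (sval p))).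
- exact: order_ge_zero.
- by move=> u v; apply: order_geD.
- by move=> a u; apply: ordM.
move=> u [j ju]; rewrite /= -[sval u]/(val u) ju -mvalueU.
by apply: order_geW (@order_geX _); rewrite mdeg1.
Qed.

(** [cancel_x] applied to each exponent of [p]. This is what makes the class of [x] regular in the
    tangent cone. *)
Lemma ideal_pow_cancel_x i (p : A) :
  ideal_pow I i.+1 (svar i0 * p) -> ideal_pow I i p.
Proof.
rewrite !ideal_powE svalM => xp k pk.
have [m mk _] := semigroup_ring_order pk.
have : ('X^(tnth (mingens B) i0) * sval p)`_(k + tnth (mingens B) i0) != 0.
  by rewrite coefXnM ltnNge leq_addl /= addnK.
move/xp => [n nv ni].
have [|l [lv le]] := cancel_x h_ge2 (m := m) (n := n).
  rewrite nv mk; congr (_ + _)%N; rewrite -mvalueU; congr mvalue.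
  by apply: mnm4P; rewrite mnm1E monE.
by exists l; [rewrite lv | lia].
Qed.

Lemma ideal_pow_cancel_xn i n (p : A) :
  ideal_pow I (n + i) (svar i0 ^+ n * p) -> ideal_pow I i p.
Proof.
elim: n p => [|n IHn] p; first by rewrite mul1r.
by rewrite addSn exprS -mulrA => /ideal_pow_cancel_x /IHn.
Qed.

(** * The tangent cone as a quotient of the Rees ring *)

Local Notation Re := (@rees A I).
Local Notation G := (tangent_cone K B).
Local Notation rval := (@rees_val A I).

Definition gr_map (F : Re) : G := \pi_({ideal_quot (@rees_shift A I)}) F.

Lemma gr_map_is_zmod : zmod_morphism gr_map.
Proof. by move=> x y; rewrite /gr_map rmorphB. Qed.

Lemma gr_map_is_monoid : monoid_morphism gr_map.
Proof. by split=> [|x y]; rewrite /gr_map ?rmorph1 ?rmorphM. Qed.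

HB.instance Definition _ := GRing.isZmodMorphism.Build Re G gr_map gr_map_is_zmod.
HB.instance Definition _ :=
  GRing.isMonoidMorphism.Build Re G gr_map gr_map_is_monoid.

Lemma gr_map_eq0 F : gr_map F = 0 <-> forall i, ideal_pow I i.+1 (rval F)`_i.
Proof.
have -> : (gr_map F = 0) <-> (F \in @rees_shift A I).
  rewrite -[F in F \in _]subr0 Quotient.idealrBE -(rmorph0 gr_map).
  by split=> [e|/eqP //]; apply/eqP.
by split=> /asboolP.
Qed.

Lemma gr_map_surj x : exists F, x = gr_map F.
Proof. by elim/quotW: x => F; exists F. Qed.

Lemma rees_coef (F : Re) i : ideal_pow I i (rval F)`_i.
Proof. by case: F => F /= /asboolP. Qed.

Lemma rvalM (p q : Re) : rval (p * q) = rval p * rval q. Proof. by []. Qed.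
Lemma rvalD (p q : Re) : rval (p + q) = rval p + rval q. Proof. by []. Qed.
Lemma rvalB (p q : Re) : rval (p - q) = rval p - rval q. Proof. by []. Qed.
Lemma rval0 : rval 0 = 0. Proof. by []. Qed.
Lemma rval1 : rval 1 = 1. Proof. by []. Qed.
Lemma rvalX (p : Re) n : rval (p ^+ n) = rval p ^+ n.
Proof. by elim: n => // n IHn; rewrite !exprS rvalM IHn. Qed.

Lemma rconst_proof (c : K) : (sconst c)%:P \in @rees_pred A I.
Proof.
by apply/asboolP => -[|i] //; rewrite coefC; apply: (@ideal_pow_gen0 _ I i.+1).
Qed.

Definition rconst (c : K) : Re := Rees (rconst_proof c).

Lemma rconst_is_zmod : zmod_morphism rconst.
Proof. by move=> c d; apply: val_inj; rewrite /= rmorphB polyCB. Qed.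

Lemma rconst_is_monoid : monoid_morphism rconst.
Proof.
by split=> [|c d]; apply: val_inj; rewrite /= ?rmorph1 // rmorphM polyCM.
Qed.

HB.instance Definition _ := GRing.isZmodMorphism.Build K Re rconst rconst_is_zmod.
HB.instance Definition _ :=
  GRing.isMonoidMorphism.Build K Re rconst rconst_is_monoid.

Lemma rvar_proof (i : 'I_4) : svar i *: 'X \in @rees_pred A I.
Proof.
apply/asboolP => j; rewrite coefZ coefX; case: eqP => [->|_].
  by rewrite mulr1; apply: ideal_gen_sub; exists (svar i), 1; rewrite svar_max mulr1.
by rewrite mulr0; apply: ideal_pow_gen0.
Qed.

(** The generator placed in degree one, so that [rmon m] sits in degree [mdeg m]. *)
Definition rvar (i : 'I_4) : Re := Rees (rvar_proof i).

Definition rmon (m : 'X_{1..4}) : Re := mmap1 rvar m.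

Lemma rval_rmon m : rval (rmon m) = smon m *: 'X^(mdeg m).
Proof.
rewrite /rmon /smon mdegE /mmap1 (big_morph rval rvalM rval1).
apply: (big_ind3 (fun (p : {poly A}) (q : A) (n : nat) => p = q *: 'X^n)).
- by rewrite scale1r.
- move=> p q n p' q' n' -> ->.
  by rewrite -scalerAl -scalerAr scalerA exprD.
by move=> i _; rewrite rvalX exprZn.
Qed.

Lemma rmonD m n : rmon (m + n)%MM = rmon m * rmon n.
Proof.
apply: val_inj; rewrite -[LHS]/(rval _) -[RHS]/(rval _ * rval _) !rval_rmon smonD.
by rewrite mdegD -scalerAl -scalerAr scalerA exprD.
Qed.

(** * The tangent cone as an algebra over [K[x]] *)

Definition rees_eval : {poly K} -> Re :=
  horner_morph (fun c => mulrC (rvar i0) (rconst c)).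

HB.instance Definition _ := GRing.RMorphism.on rees_eval.

Definition cone_eval : {rmorphism {poly K} -> G} := gr_map \o rees_eval.

Lemma rval_term c m : rval (rconst c * rmon m) = (sconst c * smon m) *: 'X^(mdeg m).
Proof. by rewrite rvalM rval_rmon /= mul_polyC scalerA. Qed.

Lemma rmon_x a : rmon (mon a 0 0 0) = rvar i0 ^+ a.
Proof.
rewrite /rmon /mmap1 !big_ord_recl big_ord0 !mnmE /tnth /= !expr0 !mulr1.
by congr (rvar _ ^+ _); apply: val_inj.
Qed.

Lemma rees_evalCX c a : rees_eval (c *: 'X^a) = rconst c * rmon (mon a 0 0 0).
Proof.
rewrite -mul_polyC rmorphM rmorphXn rmon_x /=.
by rewrite /rees_eval horner_morphC horner_morphX.
Qed.

Lemma rees_eval_coef p i : (rval (rees_eval p))`_i = sconst p`_i * svar i0 ^+ i.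
Proof.
rewrite -{1}[p]coefK poly_def rmorph_sum /= (big_morph rval rvalD rval0).
under eq_bigr do rewrite rees_evalCX rval_term mdeg4 !monE !addn0.
rewrite -(poly_def _ (fun k => sconst p`_k * smon (mon k 0 0 0))) coef_poly.
have smon_x k : smon (mon k 0 0 0) = svar i0 ^+ k.
  rewrite /smon /mmap1 !big_ord_recl big_ord0 !mnmE /tnth /= !expr0 !mulr1.
  by congr (svar _ ^+ _); apply: val_inj.
case: ltnP => [_|pi]; first by rewrite smon_x.
by rewrite nth_default // rmorph0 mul0r.
Qed.

(** The coefficient of index [i] is a combination of monomials of degree at least [i]; those of
    larger degree lie in the next power and vanish in the quotient. *)
Lemma gr_ind (Z : set G) : Z 0 -> (forall x y, Z x -> Z y -> Z (x + y)) ->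
  (forall c m, Z (gr_map (rconst c * rmon m))) -> forall x, Z x.
Proof.
move=> Z0 ZD Zm x; have [F ->] := gr_map_surj x.
have /choice [s sP] : forall i, exists s : seq (K * 'X_{1..4}),
    (rval F)`_i = \sum_(t <- s) sconst t.1 * smon t.2 /\
    forall t, t \in s -> (i <= mdeg t.2)%N.
  move=> i; have := rees_coef F i.
  by move=> /ideal_powE /semigroup_ring_decomp [s ? ?]; exists s.
pose H := \sum_(i < size (rval F)) \sum_(t <- s i | mdeg t.2 == i)
  rconst t.1 * rmon t.2.
suff -> : gr_map F = gr_map H.
  rewrite raddf_sum; apply: (big_ind Z) => // i _.
  by rewrite raddf_sum; apply: (big_ind Z).
apply/eqP; rewrite -subr_eq0 -rmorphB; apply/eqP/gr_map_eq0 => l.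
have HE : rval H = \poly_(i < size (rval F))
    \sum_(t <- s i | mdeg t.2 == i) sconst t.1 * smon t.2.
  rewrite poly_def (big_morph rval rvalD rval0); apply: eq_bigr => i _.
  rewrite (big_morph rval rvalD rval0) scaler_suml; apply: eq_bigr => t /eqP <-.
  exact: rval_term.
rewrite rvalB coefB HE coef_poly; case: ltnP => [_|Fl]; last first.
  by rewrite nth_default // subr0; apply: ideal_pow_gen0.
have [-> sl] := sP l; rewrite (bigID (fun t => mdeg t.2 == l)) /= addrAC subrr add0r.
rewrite big_seq_cond; apply: (big_ind (ideal_pow I l.+1)).
- exact: (@ideal_pow_gen0 _ I).
- by move=> *; apply: ideal_powD.
move=> t /andP[/sl lt tl]; apply: ideal_powM.
by apply: ideal_powW (ideal_pow_smon _); rewrite ltn_neqAle eq_sym tl.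
Qed.

(** With [k] the least index such that [p] has a nonzero coefficient, strong induction on [i] looks
    at the coefficient of index [k + i] in the product. *)
Lemma cone_eval_regular p r : p != 0 -> cone_eval p * r = 0 -> r = 0.
Proof.
move=> p0; have [F ->] := gr_map_surj r.
rewrite -[cone_eval p]/(gr_map (rees_eval p)) -rmorphM => /gr_map_eq0 pF.
apply/gr_map_eq0.
have exk : exists k, p`_k != 0.
  by exists (size p).-1; rewrite -/(lead_coef p) lead_coef_eq0.
case: (ex_minnP exk) => k pk kmin.
elim/ltn_ind => i IHi.
have := pF (k + i)%N; rewrite rvalM coefM.
have lt : (k < (k + i).+1)%N by rewrite ltnS leq_addr.
rewrite (bigD1 (Ordinal lt)) //= addKn rees_eval_coef => H.
have {}H : ideal_pow I (k + i).+1 (sconst p`_k * svar i0 ^+ k * (rval F)`_i).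
  (* The other terms are subtracted: for [j < k] the coefficient of [p] is zero, and for [j > k] the
     induction hypothesis puts the coefficient of [F] one power higher. *)
  rewrite -[X in ideal_pow I _ X](addrK (\sum_(j < (k + i).+1 | j != Ordinal lt)
    (rval (rees_eval p))`_j * (rval F)`_(k + i - j))).
  apply: (@ideal_powD _ I) => //.
  rewrite -mulN1r; apply: (@ideal_powM _ I).
  apply: (big_ind (ideal_pow I (k + i).+1)).
  - exact: (@ideal_pow_gen0 _ I).
  - by move=> *; apply: ideal_powD.
  move=> j jk; rewrite rees_eval_coef -mulrA.
  have [pj|pj] := eqVneq p`_j 0.
    by rewrite pj rmorph0 mul0r; apply: (@ideal_pow_gen0 _ I).
  have kj : (k < j)%N by rewrite ltn_neqAle eq_sym jk kmin.
  apply: (@ideal_powM _ I).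
  have ji : (k + i - j < i)%N by have := ltn_ord j; lia.
  have e : (k + i).+1 = (j + (k + i - j).+1)%N by have := ltn_ord j; lia.
  rewrite [X in ideal_pow _ X]e.
  apply: (@ideal_pow_mul _ I); last exact: IHi.
  apply/ideal_powE; rewrite svalX -exprM.
  have -> : 'X^(tnth (mingens B) i0 * j) = 'X^(mvalue h (mon j 0 0 0)) :> {poly K}.
    by rewrite /mvalue !monE /tnth /= mulnC !addn0.
  by apply: order_geW (@order_geX _); rewrite mdeg4 !monE !addn0.
apply: (@ideal_pow_cancel_xn i.+1 k); rewrite addnS.
have -> : svar i0 ^+ k * (rval F)`_i =
    sconst (p`_k)^-1 * (sconst p`_k * svar i0 ^+ k * (rval F)`_i).
  by rewrite !mulrA -rmorphM mulVf // rmorph1 mul1r.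
exact: (@ideal_powM _ I).
Qed.

(** [lead h i] and [tail h i] give the same element of the semigroup ring, and the tail has larger
    degree. *)
Lemma gr_lead_eq0 i : (0 < i < 4 * h)%N -> gr_map (rmon (lead h i)) = 0.
Proof.
move=> lti; have /andP[_ lti'] := lti; apply/gr_map_eq0 => j.
rewrite rval_rmon coefZ coefXn; case: eqP => [->|_]; last first.
  by rewrite mulr0; apply: (@ideal_pow_gen0 _ I).
rewrite mulr1; apply/ideal_powE; rewrite sval_smon mvalue_lead //.
by apply: order_geW (@order_geX _); apply: mdeg_lead.
Qed.

(** The rules of index [2h + 1], [1] and [2h] have left-hand sides [y^(2h)], [z^(2h-1)] and
    [w^(2h-1)]; [2h] is a common bound. *)
Lemma gr_large_eq0 a b c d : [|| 2 * h <= b, 2 * h <= c | 2 * h <= d]%N ->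
  gr_map (rmon (mon a b c d)) = 0.
Proof.
have aux i m n : (0 < i < 4 * h)%N -> (n + lead h i)%MM = m -> gr_map (rmon m) = 0.
  by move=> lti <-; rewrite rmonD rmorphM /= gr_lead_eq0 // mulr0.
case/or3P => le.
- apply: (aux (2 * h + 1)%N _ (mon a (b - 2 * h) c d)); first by lia.
  have lt : (2 * h + 1 < 4 * h)%N by lia.
  by case: (leadP lt) => [?|? ? ?|? ? ?]; apply: mnm4P; rewrite mnmDE !monE; lia.
- apply: (aux 1%N _ (mon a b (c - (2 * h - 1)) d)); first by lia.
  have lt : (1 < 4 * h)%N by lia.
  by case: (leadP lt) => [?|? ? ?|? ? ?]; apply: mnm4P; rewrite mnmDE !monE; lia.
apply: (aux (2 * h)%N _ (mon a b c (d - (2 * h - 1)))); first by lia.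
have lt : (2 * h < 4 * h)%N by lia.
by case: (leadP lt) => [?|? ? ?|? ? ?]; apply: mnm4P; rewrite mnmDE !monE; lia.
Qed.

Lemma rmon_split a b c d : rmon (mon a b c d) = rmon (mon a 0 0 0) * rmon (mon 0 b c d).
Proof.
by rewrite -rmonD; congr rmon; apply: mnm4P; rewrite mnmDE !monE ?addn0.
Qed.

(** Powers of [x] come from [K[x]]; a monomial involving [y], [z] or [w] is nilpotent. *)
Lemma gr_decomp r : exists p, nilpotent_elt (r - cone_eval p).
Proof.
move: r; apply: gr_ind.
- by exists 0; rewrite rmorph0 subr0; apply: nilpotent_elt0.
- move=> x y [p pn] [q qn]; exists (p + q); rewrite rmorphD.
  by rewrite opprD addrACA; apply: nilpotent_eltD.
move=> c m; have -> : m = mon (m i0) (m i1) (m i2) (m i3).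
  by apply: mnm4P; rewrite monE.
move: (m i0) (m i1) (m i2) (m i3) => a b {}c' d.
have [/eqP bcd0|bcd] := boolP (b + c' + d == 0)%N.
  exists (c *: 'X^a); have [-> -> ->] : [/\ b = 0, c' = 0 & d = 0]%N by split; lia.
  rewrite -[cone_eval _]/(gr_map (rees_eval _)) rees_evalCX subrr.
  exact: nilpotent_elt0.
exists 0; rewrite rmorph0 subr0 rmon_split mulrA rmorphM /=.
(* In the [2h]-th power some exponent reaches [2h]. *)
apply: nilpotent_eltM; exists (2 * h)%N; rewrite -rmorphXn.
have -> : rmon (mon 0 b c' d) ^+ (2 * h) =
    rmon (mon 0 ((2 * h) * b) ((2 * h) * c') ((2 * h) * d)).
  elim: (2 * h)%N => [|n IHn].
    rewrite /rmon -[LHS]/(1 : Re) -(mmap11 rvar); congr mmap1.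
    by apply: mnm4P; rewrite monE mnm0E.
  rewrite exprS IHn -rmonD; congr rmon.
  by apply: mnm4P; rewrite mnmDE !monE ?mulSn.
apply: gr_large_eq0; have : [|| 0 < b, 0 < c' | 0 < d]%N by lia.
by case/or3P => n0; apply/or3P; [apply: Or31|apply: Or32|apply: Or33]; apply: leq_pmulr.
Qed.

(** Monomials in [y], [z], [w] with exponents below [2h] span over [K[x]], as all larger ones
    vanish. *)
Lemma gr_noetherian : noetherian G.
Proof.
pose N := iota 0 (2 * h).
pose e := [seq gr_map (rmon (mon 0 t.1 t.2.1 t.2.2)) | t <- allpairs pair N (allpairs pair N N)].
apply: (@poly_finite_noetherian _ _ cone_eval e); apply: gr_ind.
- exact: poly_span0.
- by move=> x y; apply: poly_spanD.
move=> c m; have -> : m = mon (m i0) (m i1) (m i2) (m i3).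
  by apply: mnm4P; rewrite monE.
move: (m i0) (m i1) (m i2) (m i3) => a b {}c' d.
have [large|/norP[b2 /norP[c2 d2]]] :=
  boolP [|| 2 * h <= b, 2 * h <= c' | 2 * h <= d]%N.
  by rewrite rmorphM /= gr_large_eq0 // mulr0; apply: poly_span0.
rewrite rmon_split mulrA -rees_evalCX rmorphM.
apply: (@poly_spanM _ _ cone_eval); apply: poly_span_mem.
apply/mapP; exists (b, (c', d)) => //.
have NP n : ~~ (2 * h <= n)%N -> n \in N by rewrite -ltnNge mem_iota.
by apply: allpairs_f; [|apply: allpairs_f]; apply: NP.
Qed.

Theorem tangent_cone_cohen_macaulay : cohen_macaulay G.
Proof.
exact: thickening_cohen_macaulay cone_eval_regular gr_decomp gr_noetherian.
Qed.

End TangentCone.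

Theorem mainTheorem6 (K : fieldType) (h : nat) (h_ge2 : (2 <= h)%N) :
  num_gens (initial_ideal (toric_ideal K (bresinsky h_ge2))) (4 * h) /\
  num_gens (toric_ideal K (bresinsky h_ge2)) (4 * h) /\
  cohen_macaulay (tangent_cone K (bresinsky h_ge2)).
Proof.
split; first exact: num_gens_initial.
by split; [exact: num_gens_toric | exact: tangent_cone_cohen_macaulay].
Qed.
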